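(* For a DAG $G$, the following are equivalent: 1. $G$ has the causal gluing property; 2. $G$ has the bicausal gluing property; 3. $G$ is transitively closed and has no splits.
   Context: Directed graphs $G=(V,E)$ have a finite vertex set $V$ and edge set $E\subseteq\{(i,j)\in V\times V: i\neq j\}$; $\mathrm{pa}_i=\{j:(j,i)\in E\}$ is the set of parents of $i$, $\mathrm{an}_i$ is the set of ancestors of $i$ (vertices from which there is a directed path of length at least one to $i$), and $\mathrm{dsc}_i=\{j: i\in\mathrm{an}_j\}$. $G$ is a DAG if $i\notin\mathrm{an}_i$ for all $i$. $G$ is transitively closed if $i\in\mathrm{pa}_j$ and $j\in\mathrm{pa}_k$ imply $i\in\mathrm{pa}_k$. A split is a triplet $(i,j,k)$ of vertices (with $j\ne k$) such that $i\in\mathrm{pa}_j\cap\mathrm{pa}_k$ but $j\notin\mathrm{pa}_k$ and $k\notin\mathrm{pa}_j$. To each $v\in V$ are associated Polish spaces $\mathcal X_v,\mathcal Y_v,\mathcal Z_v$; $\mathcal X=\prod_{v\in V}\mathcal X_v$ and, for $A\subseteq V$, $\mathcal X_A=\prod_{v\in A}\mathcal X_v$, and $X_A$ is the projection of $X$ onto $\mathcal X_A$ (similarly $\mathcal Y,\mathcal Z$). $\mathcal P(\Omega)$ is the set of Borel probability measures on $\Omega$; $\Pi(\mu,\nu)$ the set of couplings. $\mu\in\mathcal P(\mathcal X)$ is $G$-compatible if, for $X\sim\mu$ and every $i\in V$, $X_i$ is conditionally independent of $X_{V\setminus(\mathrm{dsc}_i\cup\{i\})}$ given $X_{\mathrm{pa}_i}$;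 $\mathcal P^G(\mathcal X)$ is the set of such measures. For $\mu\in\mathcal P^G(\mathcal X)$, $\nu\in\mathcal P^G(\mathcal Y)$: let $G^c$ be the DAG with vertex set $\{i,i':i\in V\}$ ($i'$ a copy of $i$) and edge set $\{(i,j),(i,j'),(i',j'):(i,j)\in E\}\cup\{(i,i'):i\in V\}$, with $\mathcal X_i$ associated to $i$ and $\mathcal Y_i$ to $i'$. The set of $G$-causal couplings is $\Pi_G^c(\mu,\nu)=\Pi(\mu,\nu)\cap\mathcal P^{G^c}(\mathcal X\times\mathcal Y)$. A coupling is $G$-anticausal if its pushforward under $(x,y)\mapsto(y,x)$ lies in $\Pi_G^c(\nu,\mu)$. $\Pi_G^{bc}(\mu,\nu)$ (the $G$-bicausal couplings) is the set of couplings that are both. Gluing: for Polish spaces $\mathcal A,\mathcal B,\mathcal C$ and $\pi_1\in\mathcal P(\mathcal A\times\mathcal B)$, $\pi_2\in\mathcal P(\mathcal B\times\mathcal C)$ with the same $\mathcal B$-marginal $\nu$, disintegrate $\pi_2(db,dc)=\nu(db)\otimes\kappa(dc|b)$; the conditional independent product is $\pi_1(da,db)\otimes\kappa(dc|b)\in\mathcal P(\mathcal A\times\mathcal B\times\mathcal C)$, and the gluing of $\pi_1,\pi_2$ is its $\mathcal A\times\mathcal C$-marginal. $G$ has the causal (resp. bicausal) gluing property if for all such products of Polish spaces $\mathcal X,\mathcal Y,\mathcal Z$, all $\mu\in\mathcal P^G(\mathcal X)$, $\nu\in\mathcal P^G(\mathcal Y)$, $\eta\in\mathcal P^G(\mathcal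 Z)$, and all $\pi\in\Pi_G^c(\mu,\nu)$, $\tilde\pi\in\Pi_G^c(\nu,\eta)$ (resp. $\pi\in\Pi_G^{bc}(\mu,\nu)$, $\tilde\pi\in\Pi_G^{bc}(\nu,\eta)$), the gluing of $\pi$ and $\tilde\pi$ belongs to $\Pi_G^c(\mu,\eta)$ (resp. $\Pi_G^{bc}(\mu,\eta)$). *)

(* Defs.v *)
From HB Require Import structures.
From mathcomp Require Import all_boot all_order all_algebra.
From mathcomp Require Import all_classical all_reals all_analysis.

Set Implicit Arguments.
Unset Strict Implicit.
Unset Printing Implicit Defensive.

Import Order.TTheory GRing.Theory Num.Theory.
Import numFieldNormedType.Exports.

Local Open Scope classical_set_scope.
Local Open Scope ring_scope.

(* A directed graph on V is an irreflexive E : rel V, where E i j means that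
   (i, j) is an edge. *)
Section graphs.
Variables (V : finType) (E : rel V).

Definition parents (i : V) : {set V} := [set j | E j i]%SET.

Definition ancestors (i : V) : {set V} :=
  [set j | [exists k, E j k && connect E k i]]%SET.

Definition descendants (i : V) : {set V} := [set j | i \in ancestors j]%SET.

Definition acyclic : Prop := forall i, i \notin ancestors i.

Definition is_split (i j k : V) : Prop :=
  [/\ j != k, i \in parents j :&: parents k,
      j \notin parents k & k \notin parents j].

Definition has_no_splits : Prop := forall i j k, ~ is_split i j k.

(* G^c, with inl i for the vertex i and inr i for its copy i'. *)
Definition causal_graph : rel (V + V) := fun u v =>
  match u, v with
  | inl i, inl j => E i j
  | inl i, inr j => E i j || (i == j)
  | inr i, inr j => E i j
  | inr _, inl _ => false
  end.

End graphs.

Definition is_metric (R : realType) (T : Type) (d : T -> T -> R) : Prop :=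
  [/\ forall x y, 0 <= d x y,
      forall x y, d x y = 0 <-> x = y,
      forall x y, d x y = d y x &
      forall x y z, d x z <= d x y + d y z].

Definition metric_complete (R : realType) (T : Type) (d : T -> T -> R) : Prop :=
  forall u : nat -> T,
    (forall e : R, 0 < e -> exists N, forall m n,
        (N <= m)%N -> (N <= n)%N -> d (u m) (u n) < e) ->
    exists l, forall e : R, 0 < e -> exists N, forall n,
        (N <= n)%N -> d (u n) l < e.

Definition polish (R : realType) (T : topologicalType) : Prop :=
  (exists2 D : set T, countable D & dense D) /\
  exists d : T -> T -> R,
    [/\ is_metric d,
        forall U : set T, open U <->
          forall x, U x -> exists2 e : R, 0 < e & [set y | d x y < e] `<=` U &
        metric_complete d].

(* A topological space equipped with its Borel sigma-algebra.  Measurable types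
   are pointed, hence the pointed spaces below: this costs no generality, since
   there is no probability measure on the empty space. *)
Notation borel T := (g_sigma_algebraType (open : set (set T%type))).

HB.instance Definition _ (T U : ptopologicalType) := Pointed.on (T * U)%type.
HB.instance Definition _ (I : Type) (T : I -> ptopologicalType) :=
  Pointed.on (prod_topology T).

Lemma continuous_borel_measurable (T U : ptopologicalType) (f : T -> U) :
  continuous f -> measurable_fun [set: borel T] (f : borel T -> borel U).
Proof.
move=> /continuousP cf.
apply: (@measurability _ _ (borel T) (borel U) setT f (@open U)) => //.
by move=> _ [B oB <-]; rewrite setTI; apply: sub_sigma_algebra; exact: cf.
Qed.

Section conditional_independence.
Context (R : realType) d (Omega : measurableType d) (P : probability Omega R).
Local Open Scope ereal_scope.

(* g is a version of the conditional probability P(A | H), for H a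
   sub-sigma-algebra *)
Definition is_cond_prob (H : set (set Omega)) (A : set Omega)
    (g : Omega -> R) : Prop :=
  [/\ forall B : set R, measurable B -> H (g @^-1` B),
      P.-integrable [set: Omega] (EFin \o g) &
      forall C, H C -> \int[P]_(w in C) (g w)%:E = P (A `&` C)].

Definition sigma_of d' (T : measurableType d') (X : Omega -> T) :
    set (set Omega) :=
  preimage_set_system [set: Omega] X measurable.

(* X and Y are conditionally independent given Z:
   P(A `&` B | Z) = P(A | Z) P(B | Z) almost surely for A in sigma(X) and
   B in sigma(Y); the choice of the versions is immaterial *)
Definition cond_indep d1 d2 d3 (T1 : measurableType d1)
    (T2 : measurableType d2) (T3 : measurableType d3)
    (X : Omega -> T1) (Y : Omega -> T2) (Z : Omega -> T3) : Prop :=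
  forall A B, sigma_of X A -> sigma_of Y B ->
  exists pA pB : Omega -> R,
    [/\ is_cond_prob (sigma_of Z) A pA,
        is_cond_prob (sigma_of Z) B pB &
        is_cond_prob (sigma_of Z) (A `&` B) (fun w => pA w * pB w)%R].

End conditional_independence.

Definition subproj (V : finType) (S : V -> ptopologicalType) (A : {set V})
    (x : prod_topology S) :
    borel (prod_topology (fun v : {v : V | v \in A} => S (val v))) :=
  fun v => x (val v).
Arguments subproj {V S} A x.

(* The law under P of the random element X of \prod_v S v is G-compatible. *)
Definition compatible (R : realType) d (Omega : measurableType d)
    (P : probability Omega R) (V : finType) (E : rel V)
    (S : V -> ptopologicalType) (X : Omega -> prod_topology S) : Prop :=
  forall i : V,
    cond_indep P
      ((fun w => X w i) : Omega -> borel (S i))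
      (fun w => subproj (~: (i |: descendants E i))%SET (X w))
      (fun w => subproj (parents E i) (X w)).

Definition swap (A B : ptopologicalType) (p : borel (A * B)) :
  borel (B * A) := (p.2, p.1).

Lemma measurable_swap (A B : ptopologicalType) :
  measurable_fun [set: borel (A * B)] (@swap A B).
Proof.
apply: (@continuous_borel_measurable (A * B)%type (B * A)%type) => p.
by apply: cvg_pair; [exact: cvg_snd|exact: cvg_fst].
Qed.

HB.instance Definition _ (A B : ptopologicalType) :=
  @isMeasurableFun.Build _ _ _ _ (@swap A B) (@measurable_swap A B).

Definition drop_middle (A B C : ptopologicalType)
    (p : borel (A * B * C)) : borel (A * C) := (p.1.1, p.2).

Lemma measurable_drop_middle (A B C : ptopologicalType) :
  measurable_fun [set: borel (A * B * C)] (@drop_middle A B C).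
Proof.
apply: (@continuous_borel_measurable (A * B * C)%type (A * C)%type) => p.
apply: cvg_pair; last exact: cvg_snd.
exact: (cvg_comp fst fst cvg_fst cvg_fst).
Qed.

HB.instance Definition _ (A B C : ptopologicalType) :=
  @isMeasurableFun.Build _ _ _ _ (@drop_middle A B C)
    (@measurable_drop_middle A B C).

Definition is_coupling (R : realType) (A B : ptopologicalType)
    (mu : probability (borel A) R) (nu : probability (borel B) R)
    (pi : probability (borel (A * B)) R) : Prop :=
  (forall D : set (borel A), measurable D -> pi (fst @^-1` D) = mu D) /\
  (forall D : set (borel B), measurable D -> pi (snd @^-1` D) = nu D).

Section gluing.
Context (R : realType).
Local Open Scope ereal_scope.

(* p(da, dc) = m(da) k(dc | a) *)
Definition disintegrates (A C : ptopologicalType)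
    (p : probability (borel (A * C)) R) (m : probability (borel A) R)
    (k : borel A -> {measure set (borel C) -> \bar R}) : Prop :=
  forall D : set (borel (A * C)), measurable D ->
    p D = \int[m]_a k a (xsection D a).

Variables A B C : ptopologicalType.

(* rho is the conditional independent product
   pi1(da, db) kappa(dc | b), where pi2(db, dc) = nu(db) kappa(dc | b) *)
Definition is_cond_indep_product (nu : probability (borel B) R)
    (pi1 : probability (borel (A * B)) R)
    (pi2 : probability (borel (B * C)) R)
    (rho : probability (borel (A * B * C)) R) : Prop :=
  exists kappa : R.-pker (borel B) ~> (borel C),
    disintegrates pi2 nu kappa /\
    disintegrates rho pi1 (fun ab => kappa ab.2).

(* gamma is the gluing of pi1 and pi2, whose common B-marginal is nu *)
Definition is_gluing (nu : probability (borel B) R)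
    (pi1 : probability (borel (A * B)) R)
    (pi2 : probability (borel (B * C)) R)
    (gamma : probability (borel (A * C)) R) : Prop :=
  exists2 rho, is_cond_indep_product nu pi1 pi2 rho &
    forall D : set (borel (A * C)), measurable D ->
      gamma D = distribution rho (@drop_middle A B C) D.

End gluing.

(* The spaces attached to the vertices of G^c, and the identification of
   (\prod_v X v) * (\prod_v Y v) with their product. *)
Definition sum_spaces (V : finType) (X Y : V -> ptopologicalType)
    (w : V + V) : ptopologicalType :=
  match w with inl i => X i | inr i => Y i end.

Definition join (V : finType) (X Y : V -> ptopologicalType)
    (p : prod_topology X * prod_topology Y) : prod_topology (sum_spaces X Y) :=
  fun w => match w with inl i => p.1 i | inr i => p.2 i end.

Section causal_couplings.
Variables (R : realType) (V : finType) (E : rel V).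

Definition compatible_measure (X : V -> ptopologicalType)
    (mu : probability (borel (prod_topology X)) R) : Prop :=
  compatible mu E (fun x => x).

Definition causal_coupling (X Y : V -> ptopologicalType)
    (mu : probability (borel (prod_topology X)) R)
    (nu : probability (borel (prod_topology Y)) R)
    (pi : probability (borel (prod_topology X * prod_topology Y)) R) : Prop :=
  is_coupling mu nu pi /\ compatible pi (causal_graph E) (@join V X Y).

Definition anticausal_coupling (X Y : V -> ptopologicalType)
    (mu : probability (borel (prod_topology X)) R)
    (nu : probability (borel (prod_topology Y)) R)
    (pi : probability (borel (prod_topology X * prod_topology Y)) R) : Prop :=
  is_coupling mu nu pi /\
  causal_coupling nu mu
    (distribution pi (@swap (prod_topology X) (prod_topology Y))).

Definition bicausal_coupling (X Y : V -> ptopologicalType)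
    (mu : probability (borel (prod_topology X)) R)
    (nu : probability (borel (prod_topology Y)) R)
    (pi : probability (borel (prod_topology X * prod_topology Y)) R) : Prop :=
  causal_coupling mu nu pi /\ anticausal_coupling mu nu pi.

(* Quantifying over all gamma with [is_gluing] is quantifying over the gluing:
   it exists and is unique since the spaces are Polish. *)
Definition causal_gluing_property : Prop :=
  forall X Y Z : V -> ptopologicalType,
  (forall v, polish R (X v)) -> (forall v, polish R (Y v)) ->
  (forall v, polish R (Z v)) ->
  forall (mu : probability (borel (prod_topology X)) R)
         (nu : probability (borel (prod_topology Y)) R)
         (eta : probability (borel (prod_topology Z)) R),
  compatible_measure mu -> compatible_measure nu -> compatible_measure eta ->
  forall pi pi' gamma,
  causal_coupling mu nu pi -> causal_coupling nu eta pi' ->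
  is_gluing nu pi pi' gamma -> causal_coupling mu eta gamma.

Definition bicausal_gluing_property : Prop :=
  forall X Y Z : V -> ptopologicalType,
  (forall v, polish R (X v)) -> (forall v, polish R (Y v)) ->
  (forall v, polish R (Z v)) ->
  forall (mu : probability (borel (prod_topology X)) R)
         (nu : probability (borel (prod_topology Y)) R)
         (eta : probability (borel (prod_topology Z)) R),
  compatible_measure mu -> compatible_measure nu -> compatible_measure eta ->
  forall pi pi' gamma,
  bicausal_coupling mu nu pi -> bicausal_coupling nu eta pi' ->
  is_gluing nu pi pi' gamma -> bicausal_coupling mu eta gamma.

End causal_couplings.

(* Main.v *)
(* Conditional independence of families of coordinates is a semigraphoid.  If G
   is transitive without splits, then for each vertex i the set A of i and its
   parents and the set D of vertices unrelated to i are disjoint and closed under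
   taking ancestors, so the coordinates of (X, Y, Z) over A and over D are
   independent; moreover Z_A is independent of X given X_A because X and Z are
   independent given Y.  Together these give that Z_A is independent of (X, Z_D)
   given X_A, which is the causality condition at the copy i' of i; the condition
   at i itself follows from the one for (X, Y).  The argument is symmetric in X
   and Z, hence covers anticausality too.
   Conversely, a chain i -> j -> k without the edge i -> k, or a split, carries
   F_2-linear functions X, Y, Z of three fair bits, with Z a function of Y, for
   which (X, Y) and (Y, Z) are bicausal but (X, Z) is not causal. *)

Require Import Defs.
From HB Require Import structures.
From mathcomp Require Import all_boot all_order all_algebra.

Set Implicit Arguments.
Unset Strict Implicit.
Unset Printing Implicit Defensive.

(** * Causality in a semigraphoid *)

(** The intersection property fails for general laws, so every step is a contraction or a weak
    union, and the measure theory consists in proving these two. Both are short once independence of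
    S and T given U is read as P(A | U) = P(A | T, U) almost surely for all events A of S:
    contraction becomes transitivity of almost sure equality, and weak union says that conditioning
    on anything between U and (T, U) changes nothing. A variable is indexed by a pair (process,
    vertex) on the glued space, so one index set serves (X, Y), (Y, Z) and (X, Z). Polishness enters
    through countable bases, which make the Borel sets of a finite product those generated by its
    coordinates. In the converse, independence is certified by symmetry: translations of F_2^3
    preserve the uniform law, and one that negates a bit while fixing others makes that bit a fair
    coin independent of them. Compatibility and its failure thus reduce to finite checks on eight
    points, done by evaluation. *)

Section semigraphoid_causality.
Context (V L : finType) (E : rel V).
Hypothesis irrE : irreflexive E.
Hypothesis trE : transitive E.

Implicit Types A B D N : {set V}.
Implicit Types S T U : {set L * V}.

Definition ancestral A : Prop := forall i j, E i j -> j \in A -> i \in A.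

(** A nonempty ancestral set has a sink, and removing a sink leaves it ancestral; so ancestral sets
    are built vertex by vertex, parents first. *)
Lemma ancestral_ind (Q : {set V} -> Prop) :
  Q set0 ->
  (forall B i, ancestral B -> i \notin B -> parents E i \subset B ->
    ancestral (i |: B) -> Q B -> Q (i |: B)) ->
  forall A, ancestral A -> Q A.
Proof.
move=> Q0 QS A; have [n] := ubnP #|A|; elim: n A => // n IH A An ancA.
have [->//|/set0Pn[i0 i0A]] := eqVneq A set0.
(* By transitivity an edge from [i] to [j] makes the parents of [i] a proper subset of those of [j],
   as [i] itself is new. Hence a vertex of [A] with the most parents has no child in [A]. *)
pose i := [arg max_(i > i0 in A) #|parents E i|].
have [iA imax] : i \in A /\ forall j, j \in A -> #|parents E j| <= #|parents E i|.
  by rewrite /i; case: arg_maxnP.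
have sink j : j \in A -> ~~ E i j.
  move=> jA; apply/negP => ij; have := imax _ jA; rewrite leqNgt => /negP; apply.
  apply: proper_card; apply/properP; split.
    by apply/subsetP => k; rewrite !inE => /trE; apply.
  by exists i; rewrite !inE ?irrE.
have AE : i |: (A :\ i) = A by rewrite setD1K.
have ancB : ancestral (A :\ i).
  move=> j k jk; rewrite !inE => /andP[ki kA]; rewrite (ancA _ _ jk kA) andbT.
  by apply: contraTneq jk => ->; exact: sink.
rewrite -AE; apply: QS => //.
- by rewrite !inE eqxx.
- apply/subsetP => j; rewrite !inE => ji; rewrite (ancA _ _ ji iA) andbT.
  by apply: contraTneq ji => ->; rewrite irrE.
- by rewrite AE.
- apply: IH => //; rewrite -ltnS; apply: leq_trans An.
  by rewrite ltnS [leqRHS](cardsD1 i) iA.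
Qed.

(* Vertices carry several layers of variables: [layer a A] stands for the
   variables of layer a at the vertices of A, and [ci S T U] for the conditional
   independence of S and T given U. *)
Definition layer (a : L) A : {set L * V} := [set p | (p.1 == a) && (p.2 \in A)].

Variable ci : {set L * V} -> {set L * V} -> {set L * V} -> Prop.
Hypothesis ci_sym : forall S T U, ci S T U -> ci T S U.
Hypothesis ci_contraction : forall S T T' U,
  ci S T U -> ci S T' (T :|: U) -> ci S (T :|: T') U.
(** Decomposition and weak union in one rule, with [T'] allowed to overlap the condition. In this
    form each use costs only inclusions of index sets. *)
Hypothesis ci_weak_union : forall S T U S' T' U', ci S T U -> S' \subset S ->
  T' \subset T :|: U -> U \subset U' -> U' \subset T :|: U -> ci S' T' U'.
Hypothesis ci0 : forall S U, ci set0 S U.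

Lemma ci_contractionl S S' T U : ci S T U -> ci S' T (S :|: U) -> ci (S :|: S') T U.
Proof. by move=> /ci_sym h1 /ci_sym h2; apply/ci_sym/ci_contraction. Qed.

Definition dsc i := [set j | E i j].
Definition nondsc i := ~: (i |: dsc i).

(* The form taken by G-causality of a coupling of the layers a and b. *)
Definition causal_layers a b := forall i,
  ci (layer a [set i]) (layer a (nondsc i) :|: layer b (nondsc i))
     (layer a (parents E i)) /\
  ci (layer b [set i]) (layer a setT :|: layer b (nondsc i))
     (layer a (i |: parents E i) :|: layer b (parents E i)).

Lemma layer0 a : layer a set0 = set0.
Proof. by apply/setP => p; rewrite !inE andbF. Qed.

(** Tested at a pair, an inclusion between unions of layers is a propositional formula in equalities
    and memberships; casing on every atom decides it. *)
Local Ltac sub := apply/subsetP; let l := fresh "l" in let v := fresh "v" in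
  intros [l v];
  repeat match goal with
  | H : is_true (_ \subset _) |- _ => move/subsetP: H => /(_ v)
  end;
  rewrite !inE /=;
  repeat match goal with
  | |- context [@eq_op ?T ?x ?y] => case: (@eq_op T x y) => //=
  | |- context [?x \in ?A] => case: (x \in A) => //=
  end.

Lemma ancestral_nondsc i B : ancestral B -> i \notin B -> B \subset nondsc i.
Proof.
move=> ancB iB; apply/subsetP => j jB; rewrite !inE negb_or.
apply/andP; split; first by apply: contraNneq iB => <-.
by apply: contraNN iB => ij; exact: ancB ij jB.
Qed.

Lemma nondsc_ancestral i : ancestral (nondsc i).
Proof.
move=> j k jk; rewrite !inE !negb_or => /andP[ki ik]; apply/andP; split.
  by apply: contraNneq ik => <-.
by apply: contraNN ik => /trE; apply.
Qed.

Lemma parents_nondsc i : parents E i \subset nondsc i.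
Proof.
apply/subsetP => j; rewrite !inE negb_or => ji; apply/andP; split.
  by apply: contraTneq ji => ->; rewrite irrE.
by apply/negP => /trE-/(_ _ ji); rewrite irrE.
Qed.


Section two_layers.
Variables a b : L.
Hypothesis cab : causal_layers a b.

(** When [i] is added its parents are already in [B], so the condition at the copy of [i] applies
    given the layer a over [i |: B] and the layer b over [B]. *)
Lemma causal_ancestral A : ancestral A ->
  ci (layer b A) (layer a setT) (layer a A).
Proof.
elim/ancestral_ind; first by rewrite layer0; exact: ci0.
move=> B i ancB iB PB _ IH.
have BN := ancestral_nondsc ancB iB; have [_] := cab i.
(* Only the inclusions matter from here on; the sets are made opaque because [sub] would unfold
   membership in them. *)
move: (nondsc i) BN (parents E i) PB => N BN P PB cb.
have h1 : ci (layer b B) (layer a setT) (layer a (i |: B)).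
  by apply: (ci_weak_union IH); sub.
have h2 : ci (layer b [set i]) (layer a setT) (layer b B :|: layer a (i |: B)).
  by apply: (ci_weak_union cb); sub.
by apply: (ci_weak_union (ci_contractionl h1 h2)); sub.
Qed.

(** Induction on [A]: as [D] is ancestral and misses the new vertex [i], it consists of
    non-descendants of [i]. The conditions at [i] and at its copy then append the two variables of
    [i] to the block over [A]. *)
Lemma causal_disjoint A D : ancestral A -> ancestral D -> [disjoint A & D] ->
  ci (layer a A :|: layer b A) (layer a D :|: layer b D) set0.
Proof.
move=> + ancD; elim/ancestral_ind; first by rewrite !layer0 setU0 => _; exact: ci0.
move=> B i ancB iB PB _ IH.
rewrite (eq_disjoint (B := predU1 i (mem B))); last by move=> j; rewrite !inE.
rewrite disjointU1 => /andP[iD /IH {}IH].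
have BN := ancestral_nondsc ancB iB; have DN := ancestral_nondsc ancD iD.
have [] := cab i.
move: (nondsc i) BN DN (parents E i) PB => N BN DN P PB ca cb.
have h1 : ci (layer a [set i]) (layer a D :|: layer b D)
    (layer a B :|: layer b B :|: set0).
  by apply: (ci_weak_union ca); sub.
have h2 : ci (layer b [set i]) (layer a D :|: layer b D)
    (layer a B :|: layer b B :|: layer a [set i] :|: set0).
  by apply: (ci_weak_union cb); sub.
by apply: (ci_weak_union (ci_contractionl (ci_contractionl IH h1) h2)); sub.
Qed.

End two_layers.

Section three_layers.
Variables a b c : L.
Hypotheses (cab : causal_layers a b) (cbc : causal_layers b c).
Hypothesis glue : ci (layer a setT) (layer c setT) (layer b setT).

(** Given the whole layer b, layer a is irrelevant to c by gluing; causality of (b, c) then shrinks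
    the condition to b over [A]. *)
Lemma glue_ancestral A : ancestral A ->
  ci (layer c A) (layer a setT :|: layer b setT) (layer b A).
Proof.
move=> ancA; have h1 := causal_ancestral cbc ancA.
have h2 : ci (layer c A) (layer a setT) (layer b setT :|: layer b A).
  by apply: (ci_weak_union (ci_sym glue)); sub.
by apply: (ci_weak_union (ci_contraction h1 h2)); sub.
Qed.

Lemma glue_ancestral_ends A : ancestral A ->
  ci (layer c A) (layer a setT) (layer a A).
Proof.
move=> ancA; have h1 := causal_ancestral cab ancA.
have h2 : ci (layer c A) (layer a setT) (layer b A :|: layer a A).
  by apply: (ci_weak_union (glue_ancestral ancA)); sub.
by apply: (ci_weak_union (ci_contractionl h1 h2)); sub.
Qed.

(** Write X, Y, Z for the layers. The (X, Y) blocks are independent, and Z_A joins the first by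
    screening through Y_A. Appending Z_D is the delicate part, since it must also ignore Z_A: given
    Y this comes from the independence of the (Y, Z) blocks, and X is brought in by screening over
    [A :|: D]. *)
Lemma glue_disjoint A D : ancestral A -> ancestral D -> [disjoint A & D] ->
  ci (layer a A :|: layer b A :|: layer c A)
     (layer a D :|: layer b D :|: layer c D) set0.
Proof.
move=> ancA ancD AD.
have ancAD : ancestral (A :|: D).
  move=> i j ij; rewrite !inE => /orP[jA|jD].
    by rewrite (ancA _ _ ij jA).
  by rewrite (ancD _ _ ij jD) orbT.
have cA := glue_ancestral ancA; have cD := glue_ancestral ancD.
have cAD := glue_ancestral ancAD.
have h1 := causal_disjoint cab ancA ancD AD.
have h2 := causal_disjoint cbc ancA ancD AD.
have h3 : ci (layer c A) (layer a D :|: layer b D)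
    (layer a A :|: layer b A :|: set0).
  by apply: (ci_weak_union cA); sub.
have h4 : ci (layer b A :|: layer c A) (layer c D) (layer b D).
  by apply: (ci_weak_union h2); sub.
have h5 : ci (layer c D) (layer c A) (layer b D :|: layer b A).
  by apply: (ci_weak_union (ci_sym h4)); sub.
have h6 : ci (layer a A :|: layer a D) (layer c D)
    (layer c A :|: (layer b D :|: layer b A)).
  by apply: (ci_weak_union (ci_sym cAD)); sub.
have h7 := ci_contraction h5 (ci_sym h6).
have h8 : ci (layer c D) (layer b A) (layer b D).
  by apply: (ci_weak_union cD); sub.
have h9 : ci (layer c D) (layer c A :|: (layer a A :|: layer a D))
    (layer b A :|: layer b D).
  by rewrite (setUC (layer b A)).
have h10 : ci (layer c D) (layer a A :|: layer b A :|: layer c A)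
    (layer a D :|: layer b D :|: set0).
  by apply: (ci_weak_union (ci_contraction h8 h9)); sub.
by apply: ci_sym; exact: ci_contractionl (ci_sym (ci_contractionl h1 h3)) h10.
Qed.

Lemma glue_disjoint_ends A D : ancestral A -> ancestral D -> [disjoint A & D] ->
  ci (layer c A) (layer a setT :|: layer c D) (layer a A).
Proof.
move=> ancA ancD AD.
have ancAD : ancestral (A :|: D).
  move=> i j ij; rewrite !inE => /orP[jA|jD].
    by rewrite (ancA _ _ ij jA).
  by rewrite (ancD _ _ ij jD) orbT.
have h1 : ci (layer a D :|: layer c D) (layer c A) (layer a A).
  by apply: (ci_weak_union (ci_sym (glue_disjoint ancA ancD AD))); sub.
have h2 : ci (layer a setT) (layer c A) (layer a D :|: layer c D :|: layer a A).
  by apply: (ci_weak_union (ci_sym (glue_ancestral_ends ancAD))); sub.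
by apply: (ci_weak_union (ci_contraction (ci_sym h1) (ci_sym h2))); sub.
Qed.

Hypothesis nosplitE : has_no_splits E.

Lemma parents_ancestral i : ancestral (i |: parents E i).
Proof.
move=> j k jk; rewrite !inE => /orP[/eqP<-|/(trE jk)->]; last by rewrite orbT.
by rewrite jk orbT.
Qed.

(** This is where the absence of splits acts: a parent of an unrelated [k] that is also a parent of
    [i] would be the apex of a split. *)
Lemma unrelated_ancestral i : ancestral (nondsc i :\: parents E i).
Proof.
move=> j k jk; rewrite !inE !negb_or => /and3P[ki ki' ik].
have ij : ~~ E i j by apply: contraNN ik => /trE; apply.
rewrite ij andbT; apply/andP; split; last by apply: contraNneq ik => <-.
apply/negP => ji; apply: (nosplitE (i := j) (j := i) (k := k)); split.
- by rewrite eq_sym.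
- by rewrite !inE ji jk.
- by rewrite inE.
- by rewrite inE.
Qed.

Theorem causal_layers_trans : causal_layers a c.
Proof.
move=> i; have PN := parents_nondsc i; split.
  (* At [i] itself: over the non-descendants, an ancestral set, c is screened off by b, so it can be
     appended to the condition already known for (a, b). *)
  have [ca _] := cab i; have cN := glue_ancestral (@nondsc_ancestral i).
  move: (nondsc i) (parents E i) PN ca cN => N P PN ca cN.
  have h : ci (layer c N) (layer a [set i])
      (layer a N :|: layer b N :|: layer a P).
    by apply: (ci_weak_union cN); sub.
  by apply: (ci_weak_union (ci_contraction ca (ci_sym h))); sub.
(* At the copy of [i]: the non-descendants divide into parents and unrelated vertices. The variables
   of c at the parents move into the condition, those at the unrelated vertices stay outside it. *)
have AD : [disjoint i |: parents E i & nondsc i :\: parents E i].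
  apply/pred0P => j; rewrite !inE.
  by case: (j == i); rewrite //= ?andbF; case: (E j i).
have := glue_disjoint_ends (@parents_ancestral i) (@unrelated_ancestral i) AD.
move: (nondsc i) (parents E i) {AD} PN => N P PN h.
have h1 : ci (layer a setT :|: layer c (N :\: P)) (layer c [set i])
    (layer c P :|: layer a (i |: P)).
  by apply: (ci_weak_union (ci_sym h)); sub.
by apply: (ci_weak_union (ci_sym h1)); sub.
Qed.

End three_layers.

End semigraphoid_causality.

From mathcomp Require Import all_classical all_reals all_analysis.
From mathcomp Require Import measurable_realfun ring.

Import Order.TTheory GRing.Theory Num.Theory.
Import numFieldNormedType.Exports.

Local Open Scope classical_set_scope.
Local Open Scope ring_scope.

(** * Versions of conditional probabilities *)

Lemma ge0_integral_mfrestr (R : realType) d (Omega : measurableType d)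
    (P : {measure set Omega -> \bar R}) (f : Omega -> \bar R) (A : set Omega)
    (mA : measurable A)
    (fA : (P A < +oo)%E) : measurable_fun [set: Omega] f -> (forall w, 0 <= f w)%E ->
  (\int[mfrestr mA fA]_w f w = \int[P]_(w in A) f w)%E.
Proof.
move=> mf f0.
have mCA : measurable (~` A) by exact: measurableC.
rewrite -(setUv A) ge0_integral_setU//; last 2 first.
- by rewrite setUv.
- by apply/disj_set2P; rewrite setICr.
rewrite [X in (_ + X)%E](_ : _ = 0%E) ?adde0.
  apply: eq_measure_integral => B mB BA.
  by rewrite /= /mfrestr /mrestr setIidl.
apply: null_set_integral => //.
- exact: measurable_funTS.
- by rewrite /= /mfrestr /mrestr setICl measure0.
Qed.

Section cond_prob.
Context {R : realType} d {Omega : measurableType d} {P : probability Omega R}.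
Local Open Scope ereal_scope.
Implicit Types (F G H : set (set Omega)) (A B C : set Omega).

Definition sigma_subalgebra H := sigma_algebra setT H /\ H `<=` measurable.

Local Notation trace H := (g_sigma_algebraType H).

Lemma trace_measurableE H : sigma_subalgebra H -> @measurable _ (trace H) = H.
Proof. by case=> + _; exact: sigma_algebra_id. Qed.

Lemma trace_measurable_fun H d' (T : measurableType d') (f : Omega -> T) :
  sigma_subalgebra H ->
  measurable_fun (setT : set (trace H)) f -> measurable_fun [set: Omega] f.
Proof.
move=> sH mf _ B mB; have := mf measurableT B mB.
by rewrite trace_measurableE//; apply: sH.2.
Qed.

(** The law of this identity map is the restriction of P to [H], so passing to a coarser
    sigma-algebra becomes an instance of pushforward. *)
Definition to_trace H (sH : sigma_subalgebra H) : Omega -> trace H := id.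

Lemma measurable_to_trace H (sH : sigma_subalgebra H) :
  measurable_fun setT (to_trace sH).
Proof.
move=> _ B; rewrite trace_measurableE// setTI preimage_id.
exact: sH.2.
Qed.

HB.instance Definition _ H (sH : sigma_subalgebra H) :=
  isMeasurableFun.Build _ _ _ _ (to_trace sH) (measurable_to_trace sH).

(* The last clause contains both the defining property of P(A | H) (take
   indicators of elements of H for f) and the rule that H-measurable factors
   may be pulled out. *)
Definition condp H A (p : Omega -> R) : Prop :=
  [/\ measurable_fun (setT : set (trace H)) p, forall w, (0 <= p w)%R &
      forall f : Omega -> \bar R, (forall w, 0 <= f w) ->
      measurable_fun (setT : set (trace H)) f ->
      \int[P]_w (f w * (p w)%:E) = \int[P]_(w in A) f w].

(** Radon-Nikodym on the trace space: P(A | H) is the density of the measure sending B to P(A and B)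
    with respect to P, both restricted to [H]. *)
Lemma condp_exists H A : sigma_subalgebra H -> measurable A ->
  exists p, condp H A p.
Proof.
move=> sH mA.
have fA : P A < +oo by rewrite ltey_eq fin_num_measure.
pose QA : {finite_measure set Omega -> \bar R} := mfrestr mA fA.
pose PH := distribution P (to_trace sH).
pose Q0 : {measure set (trace H) -> \bar R} :=
  measure_function_pushforward__canonical__measure_function_Measure QA
    (measurable_to_trace sH).
have fQ : Q0 setT < +oo.
  by rewrite /= /pushforward preimage_setT ltey_eq (fin_num_measure QA).
pose Q : {finite_measure set (trace H) -> \bar R} := mfrestr measurableT fQ.
have QP : Q `<< PH.
  apply/null_content_dominatesP => B mB PB.
  have mB' : measurable (B : set Omega).
    by move: mB; rewrite trace_measurableE//; exact: sH.2.
  rewrite /Q/= /mfrestr/= /mrestr setIT /= /pushforward.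
  rewrite /QA/= /mfrestr/= /mrestr preimage_id.
  apply/eqP; rewrite eq_le measure_ge0 andbT -PB.
  change (P ((B : set Omega) `&` A) <= P (B : set Omega)).
  by apply: le_measure; rewrite ?inE//; exact: measurableI.
pose q := Radon_Nikodym_SigmaFinite.f Q PH.
have q0 := Radon_Nikodym_SigmaFinite.f_ge0 QP.
have qfin := Radon_Nikodym_SigmaFinite.f_fin_num QP.
have mq : measurable_fun setT q.
  exact: measurable_int (Radon_Nikodym_SigmaFinite.f_integrable QP).
exists (fine \o q); split.
- exact: measurableT_comp.
- by move=> w; apply: fine_ge0.
move=> f f0 mf.
transitivity (\int[PH]_w (f w * q w)).
  rewrite ge0_integral_pushforward//=.
  - by under eq_integral do rewrite fineK//.
  - exact: emeasurable_funM.
  - by move=> w _; exact: mule_ge0.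
rewrite Radon_Nikodym_SigmaFinite.change_of_variables//.
rewrite ge0_integral_mfrestr// ge0_integral_pushforward//.
rewrite preimage_setT ge0_integral_mfrestr//.
exact: trace_measurable_fun mf.
Qed.

(** Uniqueness of densities is applied on the trace space, where [f] and [g] are measurable; a null
    set found there is also null for P. *)
Lemma ae_eq_trace H (f g : Omega -> \bar R) : sigma_subalgebra H ->
  measurable_fun (setT : set (trace H)) f ->
  measurable_fun (setT : set (trace H)) g ->
  P.-integrable setT f -> P.-integrable setT g ->
  (forall C, H C -> \int[P]_(w in C) f w = \int[P]_(w in C) g w) ->
  ae_eq P setT f g.
Proof.
move=> sH mf mg intf intg fg.
pose PH := distribution P (to_trace sH).
have iPH (h : Omega -> \bar R) : measurable_fun (setT : set (trace H)) h ->
    P.-integrable setT h -> PH.-integrable setT h.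
  by move=> mh inth; exact: integrable_pushforward.
have ePH (h : Omega -> \bar R) C : measurable_fun (setT : set (trace H)) h ->
    P.-integrable setT h -> H C ->
    \int[PH]_(w in C) h w = \int[P]_(w in C) h w.
  move=> mh inth HC; rewrite integral_pushforward//.
    by apply: integrableS inth => //; exact: sH.2.
  by rewrite trace_measurableE.
have : ae_eq PH setT f g.
  apply: integral_ae_eq => //; first exact: iPH.
  move=> C _; rewrite trace_measurableE// => HC.
  by rewrite !ePH//; exact: fg.
move=> [N [mN N0 sN]]; exists N; split => //.
by move: mN; rewrite trace_measurableE//; exact: sH.2.
Qed.

End cond_prob.
Arguments condp {R d Omega} P H A p.

(** A version fixed by choice removes the existential quantifiers from conditional independence. By
    [condp_exists] the default 0 is not met for a measurable event and a sub-sigma-algebra. *)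
HB.lock Definition cp (R : realType) d (Omega : measurableType d)
    (P : probability Omega R) (H : set (set Omega)) (A : set Omega) : Omega -> R :=
  xget (fun=> 0%R) [set p | condp P H A p].
Arguments cp {R d Omega} P H A _.
Canonical cp_unlockable := Unlockable cp.unlock.

Section cond_prob_version.
Context {R : realType} d {Omega : measurableType d} {P : probability Omega R}.
Local Open Scope ereal_scope.
Implicit Types (F G H : set (set Omega)) (A B C : set Omega).
Local Notation trace H := (g_sigma_algebraType H).
Local Notation cp := (cp P).
Local Notation condp := (condp P).

Section cp_theory.
Variables (H : set (set Omega)).
Hypothesis sH : sigma_subalgebra H.

Lemma cpP A : measurable A -> condp H A (cp H A).
Proof.
move=> mA; rewrite unlock.
apply: (@xgetPex _ (fun=> 0%R) [set p | condp H A p]).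
exact: condp_exists.
Qed.

Lemma cp_ge0 A w : measurable A -> (0 <= cp H A w)%R.
Proof. by move=> /cpP[]. Qed.

Lemma measurable_trace_cp A : measurable A ->
  measurable_fun (setT : set (trace H)) (cp H A).
Proof. by move=> /cpP[]. Qed.

Lemma measurable_cp A : measurable A -> measurable_fun setT (cp H A).
Proof. by move=> mA; exact: trace_measurable_fun (measurable_trace_cp mA). Qed.

Lemma preimage_cp A (B : set R) : measurable A -> measurable B ->
  H (cp H A @^-1` B).
Proof.
move=> mA mB; have := measurable_trace_cp mA measurableT mB.
by rewrite trace_measurableE// setTI.
Qed.

Lemma integral_Mcp A C (f : Omega -> \bar R) : measurable A ->
  (forall w, 0 <= f w) -> measurable_fun (setT : set (trace H)) f -> H C ->
  \int[P]_(w in C) (f w * (cp H A w)%:E) = \int[P]_(w in A `&` C) f w.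
Proof.
move=> mA f0 mf HC; rewrite integral_mkcond integral_mkcondr.
have [_ _ <-] := cpP mA.
- apply: eq_integral => w _; rewrite !patchE; case: ifPn => //.
  by rewrite mul0e.
- by move=> w; rewrite patchE; case: ifPn.
- apply/(measurable_restrictT _ _).1 => //.
    by rewrite trace_measurableE.
  exact: measurable_funTS.
Qed.

Lemma integral_cp A C : measurable A -> H C ->
  \int[P]_(w in C) (cp H A w)%:E = P (A `&` C).
Proof.
move=> mA HC; have := @integral_Mcp A C (cst 1) mA.
under eq_integral do rewrite mul1e.
by move=> ->//; rewrite integral_cst ?mul1e//; apply: measurableI => //; exact: sH.2.
Qed.

Lemma integrable_cp A : measurable A -> P.-integrable setT (EFin \o cp H A).
Proof.
move=> mA; apply/integrableP; split.
  by apply/measurable_EFinP; exact: measurable_cp.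
under eq_integral.
  move=> w _; rewrite gee0_abs ?lee_fin ?cp_ge0//; over.
rewrite integral_cp//; last by rewrite -(trace_measurableE sH).
by rewrite ltey_eq fin_num_measure//; exact: measurableI.
Qed.

Lemma cp_unique A (g : Omega -> R) : measurable A ->
  measurable_fun (setT : set (trace H)) g ->
  P.-integrable setT (EFin \o g) ->
  (forall C, H C -> \int[P]_(w in C) (g w)%:E = P (A `&` C)) ->
  ae_eq P setT (EFin \o cp H A) (EFin \o g).
Proof.
move=> mA mg intg gE; apply: (ae_eq_trace sH) => //.
- by apply/measurable_EFinP; exact: measurable_trace_cp.
- exact/measurable_EFinP.
- exact: integrable_cp.
- by move=> C HC; rewrite /= integral_cp// gE.
Qed.

(** Conditional independence with a single conditional probability. Pulling P(A | H) out of the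
    integral turns the left side into the integral of P(A | H) P(B | H) over [C], whence the
    symmetry and the link with the usual product formula. *)
Definition indep A B :=
  forall C, H C -> \int[P]_(w in B `&` C) (cp H A w)%:E = P (A `&` B `&` C).

Lemma integral_cpM A B C : measurable A -> measurable B -> H C ->
  \int[P]_(w in C) (cp H A w * cp H B w)%:E = \int[P]_(w in B `&` C) (cp H A w)%:E.
Proof.
move=> mA mB HC; rewrite -integral_Mcp//.
- by move=> w; rewrite lee_fin cp_ge0.
- by apply/measurable_EFinP; exact: measurable_trace_cp.
Qed.

Lemma indep_sym A B : measurable A -> measurable B -> indep A B -> indep B A.
Proof.
move=> mA mB iAB C HC.
rewrite -(integral_cpM mB mA HC) (setIC B) -(iAB _ HC) -(integral_cpM mA mB HC).
by apply: eq_integral => w _; rewrite mulrC.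
Qed.

End cp_theory.

Lemma ae_eq_indep H K A B : sigma_subalgebra H -> sigma_subalgebra K ->
  H `<=` K -> measurable A -> K B ->
  ae_eq P setT (EFin \o cp H A) (EFin \o cp K A) -> indep H A B.
Proof.
move=> sH sK HK mA KB HKE C HC.
have KBC : K (B `&` C).
  rewrite -(trace_measurableE sK); apply: measurableI; rewrite trace_measurableE//.
  exact: HK.
have mBC : measurable (B `&` C) by exact: sK.2.
rewrite -setIA -(integral_cp sK)//; apply: ae_eq_integral => //.
- by apply/measurable_EFinP/measurable_funTS; exact: measurable_cp.
- by apply/measurable_EFinP/measurable_funTS; exact: measurable_cp.
- exact: ae_eq_subset HKE.
Qed.

Lemma sigma_subalgebra_smallest (G : set (set Omega)) :
  G `<=` measurable -> sigma_subalgebra <<s G >>.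
Proof.
move=> Gm; split; first exact: smallest_sigma_algebra.
by apply: smallest_sub => //; exact: sigma_algebra_measurable.
Qed.

(** By hypothesis P(A | H) has the right integral over B and C jointly, for B in [G] and C in [H].
    Such intersections form a pi-system generating the join, and the sets with the right integral
    form a Dynkin system, so P(A | H) is a version of P(A | G, H). *)
Lemma indep_ae_eq G H A : sigma_subalgebra G -> sigma_subalgebra H ->
  measurable A -> (forall B, G B -> indep H A B) ->
  ae_eq P setT (EFin \o cp H A) (EFin \o cp <<s G `|` H >> A).
Proof.
move=> sG sH mA iA.
have sK : sigma_subalgebra <<s G `|` H >>.
  by apply: sigma_subalgebra_smallest; rewrite subUset; split; [exact: sG.2|exact: sH.2].
suff key C : <<s G `|` H >> C -> \int[P]_(w in C) (cp H A w)%:E = P (A `&` C).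
  apply/ae_eq_sym/cp_unique => //; last exact: integrable_cp.
  move=> _ B mB; rewrite trace_measurableE//; apply: sub_sigma_algebra; right.
  by rewrite setTI; exact: preimage_cp.
have HT : H setT by rewrite -(trace_measurableE sH).
have GT : G setT by rewrite -(trace_measurableE sG).
pose G0 := [set B `&` C | B in G & C in H].
have G0K : <<s G `|` H >> `<=` <<s G0 >>.
  apply: smallest_sub; first exact: smallest_sigma_algebra.
  move=> B [GB|HB]; apply: sub_sigma_algebra.
    by exists B => //; exists setT; rewrite ?setIT.
  by exists setT => //; exists B; rewrite ?setTI.
have G0m : G0 `<=` measurable.
  by move=> _ [B GB] [D HD] <-; apply: measurableI; [exact: sG.2|exact: sH.2].
move/G0K => {}G0C.
have mcp D : measurable_fun D (EFin \o cp H A).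
  by apply/measurable_EFinP/measurable_funTS; exact: measurable_cp.
have cp0 w : 0 <= (EFin \o cp H A) w by rewrite lee_fin cp_ge0.
suff : <<s G0 >> `<=`
    [set C | measurable C /\ \int[P]_(w in C) (cp H A w)%:E = P (A `&` C)].
  by move=> /(_ _ G0C)[].
apply: lambda_system_subset => //.
- move=> _ _ [B GB] [D HD] <- [B' GB'] [D' HD'] <-.
  exists (B `&` B').
    by rewrite -(trace_measurableE sG); apply: measurableI; rewrite trace_measurableE.
  exists (D `&` D'); last by rewrite setIACA.
  by rewrite -(trace_measurableE sH); apply: measurableI; rewrite trace_measurableE.
- apply/dynkin_lambda_system; split.
  + by split => //; rewrite integral_cp.
  + move=> B [mB BE]; split; first exact: measurableC.
    have : \int[P]_w (cp H A w)%:E = P (A `&` setT) by rewrite integral_cp.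
    rewrite -(setUv B) ge0_integral_setU//; last 3 first.
    * exact: measurableC.
    * by move=> w _; exact: cp0.
    * by apply/disj_set2P; rewrite setICr.
    rewrite BE setIUr measureU//; last 3 first.
    * exact: measurableI.
    * by apply: measurableI => //; exact: measurableC.
    * by rewrite setIACA setICr setI0.
    move=> /(congr1 (fun x => x - P (A `&` B))).
    have ABfin : P (A `&` B) \is a fin_num.
      by rewrite fin_num_measure//; exact: measurableI.
    by rewrite addeAC subee// add0e addeAC subee// add0e.
  + move=> F tF mF; split; first by apply: bigcup_measurable => k _; exact: (mF k).1.
    rewrite ge0_integral_bigcup//; last 2 first.
    * by move=> k; exact: (mF k).1.
    * by move=> w _; exact: cp0.
    rewrite setI_bigcupr measure_bigcup//; last 2 first.
    * by move=> k _; apply: measurableI => //; exact: (mF k).1.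
    * exact: trivIset_setIl.
    rewrite (@eq_eseriesl _ _ (fun k => k \in [set: nat])); last first.
      by move=> k; rewrite in_setT.
    by apply: eq_eseriesr => k _; exact: (mF k).2.
- move=> _ [B GB] [D HD] <-; split.
    by apply: measurableI; [exact: sG.2|exact: sH.2].
  by rewrite iA// setIA.
Qed.

End cond_prob_version.
Arguments indep {R d Omega} P H A B.

(** * Conditional independence under image laws *)

Section transfer.
Context (R : realType) d (Omega : measurableType d) (P : probability Omega R).
Context d' (Omega' : measurableType d') (Q : probability Omega' R).
Variable phi : Omega -> Omega'.
Hypothesis mphi : measurable_fun setT phi.
Hypothesis QE : forall D, measurable D -> Q D = P (phi @^-1` D).
Local Open Scope ereal_scope.

Lemma ge0_integral_law (f : Omega' -> \bar R) D : measurable D ->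
  measurable_fun setT f -> (forall w, 0 <= f w) ->
  \int[Q]_(w in D) f w = \int[P]_(w in phi @^-1` D) f (phi w).
Proof.
move=> mD mf f0.
rewrite -(ge0_integral_pushforward mphi P)//; last exact: measurable_funTS.
by apply: eq_measure_integral => B mB _; exact: QE.
Qed.

Section preimage.
Variable H : set (set Omega').
Hypothesis sH : sigma_subalgebra H.
Let H' := preimage_set_system setT phi H.

Lemma sigma_subalgebra_preimage : sigma_subalgebra H'.
Proof.
split; first exact: sigma_algebra_preimage sH.1.
by move=> _ [D HD <-]; apply: mphi => //; exact: sH.2.
Qed.

(** Composed with [phi], a version for [Q] is measurable for the pulled-back sigma-algebra and keeps
    its integrals by change of variables; uniqueness concludes. *)
Lemma cp_law A : measurable A ->
  ae_eq P setT (EFin \o cp P H' (phi @^-1` A)) (EFin \o (cp Q H A \o phi)).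
Proof.
move=> mA; apply: cp_unique.
- exact: sigma_subalgebra_preimage.
- by rewrite -[X in measurable X]setTI; exact: mphi.
- move=> _ B mB; rewrite trace_measurableE; last exact: sigma_subalgebra_preimage.
  exists (cp Q H A @^-1` B); last by rewrite comp_preimage.
  exact: preimage_cp.
- have /integrableP[_ fin] := integrable_cp (P := Q) sH mA.
  apply/integrableP; split.
    apply/measurable_EFinP; apply: measurableT_comp => //.
    exact: measurable_cp.
  rewrite -(@ge0_integral_law (fun w => `|(cp Q H A w)%:E|) setT)//.
  apply: measurableT_comp => //; apply/measurable_EFinP; exact: measurable_cp.
- move=> _ [C HC <-]; rewrite setTI -preimage_setI -QE; last first.
    by apply: measurableI => //; exact: sH.2.
  rewrite -(integral_cp sH)// ge0_integral_law//.
  + exact: sH.2.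
  + by apply/measurable_EFinP; exact: measurable_cp.
  + by move=> w; rewrite lee_fin cp_ge0.
Qed.

Lemma indep_law A B : measurable A -> measurable B ->
  indep Q H A B <-> indep P H' (phi @^-1` A) (phi @^-1` B).
Proof.
move=> mA mB.
have mcp : measurable_fun setT (EFin \o cp Q H A).
  by apply/measurable_EFinP; exact: measurable_cp.
have mpre D : measurable D -> measurable (phi @^-1` D).
  by move=> mD; rewrite -[X in measurable X]setTI; exact: mphi.
suff key C : H C -> \int[P]_(w in phi @^-1` (B `&` C)) (cp P H' (phi @^-1` A) w)%:E =
    \int[Q]_(w in B `&` C) (cp Q H A w)%:E.
  have mABC C : H C -> measurable (A `&` B `&` C).
    by move=> HC; apply: measurableI; [exact: measurableI|exact: sH.2].
  split=> [iAB _ [C HC <-]|iAB C HC].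
    rewrite setTI.
    exact: etrans (key C HC) (etrans (iAB C HC) (QE (mABC C HC))).
  have H'C : H' (phi @^-1` C) by exists C => //; rewrite setTI.
  have e := iAB _ H'C.
  exact: etrans (esym (key C HC)) (etrans e (esym (QE (mABC C HC)))).
move=> HC; have mBC : measurable (B `&` C) by apply: measurableI => //; exact: sH.2.
rewrite (@ge0_integral_law (EFin \o cp Q H A))//; last first.
  by move=> w; rewrite lee_fin cp_ge0.
apply: ae_eq_integral => //.
- exact: mpre.
- apply/measurable_EFinP/measurable_funTS/measurable_cp; last exact: mpre.
  exact: sigma_subalgebra_preimage.
- by apply: measurable_funTS; exact: measurableT_comp.
- exact: (ae_eq_subset _ (cp_law mA)).
Qed.

End preimage.
End transfer.

Section cond_indep_indep.
Context (R : realType) d (Omega : measurableType d) (P : probability Omega R).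
Local Open Scope ereal_scope.

Lemma sigma_subalgebra_sigma_of d' (T : measurableType d') (X : Omega -> T) :
  measurable_fun setT X -> sigma_subalgebra (sigma_of X).
Proof.
move=> mX; apply: sigma_subalgebra_preimage => //; split => //.
exact: sigma_algebra_measurable.
Qed.

Lemma is_cond_prob_cp H A p : sigma_subalgebra H -> measurable A ->
  is_cond_prob P H A p -> ae_eq P setT (EFin \o cp P H A) (EFin \o p).
Proof.
move=> sH mA [mp intp pE]; apply: cp_unique => //.
by move=> _ B mB; rewrite trace_measurableE// setTI; exact: mp.
Qed.

Lemma cp_is_cond_prob H A : sigma_subalgebra H -> measurable A ->
  is_cond_prob P H A (cp P H A).
Proof.
move=> sH mA; split.
- by move=> B mB; exact: preimage_cp.
- exact: integrable_cp.
- by move=> C HC; exact: integral_cp.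
Qed.

(** Any two versions agree almost surely, so the versions in the definition can be replaced by
    [cp]. *)
Lemma cond_indepP d1 d2 d3 (T1 : measurableType d1)
    (T2 : measurableType d2) (T3 : measurableType d3)
    (X : Omega -> T1) (Y : Omega -> T2) (Z : Omega -> T3) :
  measurable_fun setT X -> measurable_fun setT Y -> measurable_fun setT Z ->
  cond_indep P X Y Z <->
  (forall A B, sigma_of X A -> sigma_of Y B -> indep P (sigma_of Z) A B).
Proof.
move=> mX mY mZ.
have sX := sigma_subalgebra_sigma_of mX.
have sY := sigma_subalgebra_sigma_of mY.
have sZ := sigma_subalgebra_sigma_of mZ.
split=> ci A B XA YB.
  have mA := sX.2 _ XA; have mB := sY.2 _ YB.
  have [pA [pB []]] := ci _ _ XA YB.
  move=> /(is_cond_prob_cp sZ mA) eA /(is_cond_prob_cp sZ mB) eB [mp intp pE] C HC.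
  rewrite -integral_cpM// -pE//.
  have mC : measurable C by exact: sZ.2.
  apply: ae_eq_integral => //.
  - apply/measurable_EFinP/measurable_funTS/measurable_funM; exact: measurable_cp.
  - exact: measurable_funTS (measurable_int _ intp).
  - apply: (ae_eq_subset (@subsetT _ C)).
    by apply: filterS2 eA eB => w /= /(_ I)[->] /(_ I)[->].
have mA := sX.2 _ XA; have mB := sY.2 _ YB.
exists (cp P (sigma_of Z) A), (cp P (sigma_of Z) B); split.
- exact: cp_is_cond_prob.
- exact: cp_is_cond_prob.
have mp : measurable_fun (setT : set (g_sigma_algebraType (sigma_of Z)))
    (fun w => cp P (sigma_of Z) A w * cp P (sigma_of Z) B w)%R.
  by apply: measurable_funM; exact: measurable_trace_cp.
have pE C : sigma_of Z C ->
    \int[P]_(w in C) (cp P (sigma_of Z) A w * cp P (sigma_of Z) B w)%:E =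
    P (A `&` B `&` C).
  by move=> HC; rewrite integral_cpM// ci.
split => //.
- move=> D mD; have := mp measurableT D mD.
  by rewrite trace_measurableE// setTI.
- apply/integrableP; split.
    by apply/measurable_EFinP; exact: trace_measurable_fun mp.
  under eq_integral.
    move=> w _; rewrite gee0_abs ?lee_fin ?mulr_ge0 ?cp_ge0//; over.
  rewrite pE; last by rewrite -(trace_measurableE sZ).
  rewrite ltey_eq fin_num_measure//; apply: measurableI => //.
  exact: measurableI.
Qed.

End cond_indep_indep.

Lemma sigma_of_comp d d' d'' (T : measurableType d) (T' : measurableType d')
    (T'' : measurableType d'') (f : T' -> T'') (g : T -> T') :
  sigma_of (f \o g) = preimage_set_system setT g (sigma_of f).
Proof.
apply/seteqP; split => [_ [B mB <-]|_ [_ [B mB <-] <-]].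
  by exists (f @^-1` B); rewrite ?setTI//; exists B; rewrite ?setTI.
by exists B; rewrite ?setTI.
Qed.

(** Conditional independence depends only on the joint law. Couplings given as abstract laws can
    therefore be studied on the glued space, or on the space of three bits. *)
Lemma cond_indep_law (R : realType) d (Omega : measurableType d)
    (P : probability Omega R) d' (Omega' : measurableType d')
    (Q : probability Omega' R) (phi : Omega -> Omega')
    d1 d2 d3 (T1 : measurableType d1)
    (T2 : measurableType d2) (T3 : measurableType d3)
    (X : Omega' -> T1) (Y : Omega' -> T2) (Z : Omega' -> T3) :
  measurable_fun setT phi ->
  (forall D, measurable D -> Q D = P (phi @^-1` D)) ->
  measurable_fun setT X -> measurable_fun setT Y -> measurable_fun setT Z ->
  cond_indep Q X Y Z <-> cond_indep P (X \o phi) (Y \o phi) (Z \o phi).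
Proof.
move=> mphi QE mX mY mZ.
have sX := sigma_subalgebra_sigma_of mX.
have sY := sigma_subalgebra_sigma_of mY.
have sZ := sigma_subalgebra_sigma_of mZ.
rewrite cond_indepP//.
rewrite (cond_indepP P (measurableT_comp mX mphi) (measurableT_comp mY mphi)
  (measurableT_comp mZ mphi)).
rewrite (sigma_of_comp X) (sigma_of_comp Y) (sigma_of_comp Z).
split=> [ci _ _ [A XA <-] [B YB <-]|ci A B XA YB].
  rewrite !setTI.
  by apply/(indep_law mphi QE sZ (sX.2 _ XA) (sY.2 _ YB)); exact: ci.
apply/(indep_law mphi QE sZ (sX.2 _ XA) (sY.2 _ YB)).
by apply: ci; [exists A|exists B]; rewrite ?setTI.
Qed.

(** * Conditional independence of families of sigma-algebras is a semigraphoid *)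

Section semigraphoid.
Context (R : realType) d (Omega : measurableType d) (P : probability Omega R).
Context (K : finType) (s : K -> set (set Omega)).
Hypothesis sm : forall k, s k `<=` measurable.
Implicit Types S T U : {set K}.

Definition joint_sigma S : set (set Omega) := <<s \bigcup_(k in [set` S]) s k >>.

Lemma sigma_subalgebra_joint S : sigma_subalgebra (joint_sigma S).
Proof. by apply: sigma_subalgebra_smallest; exact: bigcup_sub. Qed.

Lemma joint_sigmaS S T : S \subset T -> joint_sigma S `<=` joint_sigma T.
Proof.
move=> ST; apply: sub_sigma_algebra2; apply: bigcup_subset => k /=.
exact: (fintype.subsetP ST).
Qed.

Lemma joint_sigmaU S T :
  <<s joint_sigma S `|` joint_sigma T >> = joint_sigma (S :|: T).
Proof.
apply/seteqP; split.
  apply: smallest_sub; first exact: smallest_sigma_algebra.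
  rewrite subUset; split; apply: joint_sigmaS.
    exact: finset.subsetUl.
  exact: finset.subsetUr.
apply: smallest_sub; first exact: smallest_sigma_algebra.
move=> A [k /=]; rewrite !inE => /orP[kS|kT] skA; apply: sub_sigma_algebra.
- by left; apply: sub_sigma_algebra; exists k.
- by right; apply: sub_sigma_algebra; exists k.
Qed.

Definition CI S T U := forall A B, joint_sigma S A -> joint_sigma T B ->
  indep P (joint_sigma U) A B.

Let sj := sigma_subalgebra_joint.
Let mj S A : joint_sigma S A -> measurable A.
Proof. exact: (sj S).2. Qed.

Lemma CIP S T U : CI S T U <-> (forall A, joint_sigma S A ->
  ae_eq P setT (EFin \o cp P (joint_sigma U) A) (EFin \o cp P (joint_sigma (T :|: U)) A)).
Proof.
split=> [ci A SA|ci A B SA TB].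
  rewrite -joint_sigmaU; apply: indep_ae_eq => //.
  - exact: mj SA.
  - by move=> B; exact: ci.
apply: (ae_eq_indep _ _ _ _ _ (ci A SA)) => //.
- by apply: joint_sigmaS; exact: finset.subsetUr.
- exact: mj SA.
- by apply: joint_sigmaS TB; exact: finset.subsetUl.
Qed.

Lemma CI_sym S T U : CI S T U -> CI T S U.
Proof.
move=> ci A B TA SB; apply: indep_sym => //.
- exact: mj SB.
- exact: mj TA.
- exact: ci.
Qed.

Lemma CI_contraction S T T' U : CI S T U -> CI S T' (T :|: U) -> CI S (T :|: T') U.
Proof.
move=> /CIP ci1 /CIP ci2; apply/CIP => A SA.
apply: ae_eq_trans (ci1 A SA) _; have := ci2 A SA.
by rewrite finset.setUCA finset.setUA.
Qed.

Lemma CI_weak_union S T U S' T' U' : CI S T U -> S' \subset S ->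
  T' \subset T :|: U -> U \subset U' -> U' \subset T :|: U -> CI S' T' U'.
Proof.
move=> /CIP ci S'S T'TU UU' U'TU; apply/CIP => A S'A.
have SA := joint_sigmaS S'S S'A; have mA := mj S'A.
(* For [W] between [U] and [T :|: U], the function P(A | U) is [W]-measurable and, being equal to
   P(A | T, U), has the right integrals over events of [W]. *)
have cpE (W : {set K}) : U \subset W -> W \subset T :|: U ->
    ae_eq P setT (EFin \o cp P (joint_sigma W) A) (EFin \o cp P (joint_sigma U) A).
  move=> UW WTU; apply: cp_unique => //.
  - move=> _ B mB; rewrite trace_measurableE//; apply: (joint_sigmaS UW).
    by rewrite setTI; exact: (preimage_cp (sj U)).
  - exact: integrable_cp.
  move=> C WC; have mC := mj WC.
  rewrite -(integral_cp (sj (T :|: U)))//; last exact: joint_sigmaS WC.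
  apply: ae_eq_integral => //.
  - by apply/measurable_EFinP/measurable_funTS; exact: measurable_cp.
  - by apply/measurable_EFinP/measurable_funTS; exact: measurable_cp.
  - exact: ae_eq_subset (ci A SA).
apply: ae_eq_trans (cpE _ UU' U'TU) _; apply/ae_eq_sym/cpE.
- exact: fintype.subset_trans UU' (finset.subsetUr _ _).
- by rewrite finset.subUset T'TU.
Qed.

End semigraphoid.

(** * Borel sets of finite products *)

Definition is_base (T : topologicalType) (I : Type) (B : I -> set T) : Prop :=
  (forall i, open (B i)) /\
  forall U x, open U -> U x -> exists2 i, B i x & B i `<=` U.

Lemma polish_base (R : realType) (T : topologicalType) :
  polish R T -> exists B : nat * nat -> set T, is_base B.
Proof.
move=> [[D /countable_injP[f finj] denseD] [d [[d0 dxx dC dT] openE _]]].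
(* Balls of radius 1/(k+1) about the points of [D], each centre being named by its code under [f]. A
   number that codes no point gives the empty set, so all pairs can serve as indices. *)
pose B (i : nat * nat) : set T :=
  [set y | exists x, [/\ D x, f x = i.1 & d x y < i.2.+1%:R^-1]].
exists B; split=> [[n k]|U x /openE oU /oU[e e0 eU]].
  apply/openE => y [x [Dx fx xy]]; exists (k.+1%:R^-1 - d x y).
    by rewrite subr_gt0.
  move=> z /= yz; exists x; split => //=.
  by rewrite (le_lt_trans (dT x y z))// -ltrBrDl.
have [k ke] : exists k, k.+1%:R^-1 < e / 2.
  have e20 : 0 < e / 2 by rewrite divr_gt0.
  exists (Num.truncn (e / 2)^-1); rewrite invf_plt ?posrE ?ltr0Sn//.
  by rewrite truncnS_gt.
have [q [xq Dq]] : [set y | d x y < k.+1%:R^-1] `&` D !=set0.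
  apply: denseD; first by exists x; rewrite /= (dxx x x).2.
  apply/openE => y /= xy; exists (k.+1%:R^-1 - d x y); first by rewrite subr_gt0.
  by move=> z /= yz; rewrite (le_lt_trans (dT x y z))// -ltrBrDl.
exists (f q, k); first by exists q; split => //=; rewrite dC.
move=> y [q' [Dq' /finj fq' /= q'y]]; apply: eU => /=.
move: q'y; rewrite fq' ?inE// => qy.
by rewrite (le_lt_trans (dT x q y))// [e]splitr ltrD// (lt_trans _ ke).
Qed.

Lemma prod_topology_nbhs (J : finType) (S : J -> topologicalType)
    (x : prod_topology S) (U : set (prod_topology S)) : open U -> U x ->
  exists2 O : forall j, set (S j), (forall j, open_nbhs (x j) (O j)) &
    [set y | forall j, O j (y j)] `<=` U.
Proof.
move=> oU Ux.
(* The filter of open boxes around [x]. Convergence to [x] is coordinatewise, and a neighbourhood in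
   one coordinate contains a box that is unrestricted in the others. *)
pose F := filter_from [set O : forall j, set (S j) | forall j, open_nbhs (x j) (O j)]
  (fun O => [set y : prod_topology S | forall j, O j (y j)]).
have FF : Filter F.
  apply: filter_from_filter.
    by exists (fun j => setT) => j; split => //; exact: openT.
  move=> O O' xO xO'; exists (fun j => O j `&` O' j).
    by move=> j; split; [apply: openI; [exact: (xO j).1|exact: (xO' j).1]|
      split; [exact: (xO j).2|exact: (xO' j).2]].
  by move=> y yO; split=> j; have [] := yO j.
suff : F --> x by move=> /(_ U); apply; exact: open_nbhs_nbhs.
apply/cvg_sup => j A [_ [[B oB <-] xB] BA].
exists (dfwith (fun k => setT) j B).
  move=> k; case: dfwithP => [|k' _]; first by split.
  by split => //; exact: openT.
by move=> y /(_ j); rewrite dfwithin => /BA.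
Qed.

Lemma prod_topology_continuous (T : topologicalType) (J : Type)
    (S : J -> topologicalType) (f : T -> prod_topology S) :
  (forall j, continuous (fun t => f t j)) -> continuous f.
Proof.
move=> cf t; apply/cvg_sup => j A [_ [[B oB <-] xB] BA].
apply: (filterS BA); apply: (cf j t).
exact: open_nbhs_nbhs.
Qed.

Lemma coordinate_continuous (J : Type) (S : J -> topologicalType) j :
  continuous (fun x : prod_topology S => x j).
Proof.
move=> x A nA; have : nbhs x --> x by exact: cvg_id.
move=> /cvg_sup/(_ j); apply.
exact: (@initial_continuous _ _ (fun y : prod_topology S => y j)).
Qed.

Lemma prod_base (J : finType) (S : J -> topologicalType) (I : Type)
    (B : forall j, I -> set (S j)) : (forall j, is_base (B j)) ->
  is_base (fun c : {ffun J -> I} =>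
    [set x : prod_topology S | forall j, B j (c j) (x j)]).
Proof.
move=> baseB; split=> [c|U x oU Ux].
  rewrite openE => x xc; apply: (filter_forall (nbhs_filter x)) => j.
  apply: (@coordinate_continuous _ _ j x).
  by apply: open_nbhs_nbhs; split; [exact: (baseB j).1|exact: xc].
have [W xW WU] := prod_topology_nbhs oU Ux.
have /choice[c cP] j : exists i, B j i (x j) /\ B j i `<=` W j.
  by have [i ? ?] := (baseB j).2 _ _ (xW j).1 (xW j).2; exists i.
exists [ffun j => c j] => [j|y yc]; rewrite ?ffunE; first exact: (cP j).1.
by apply: WU => j; apply: (cP j).2; have := yc j; rewrite ffunE.
Qed.

Lemma pair_base (T T' : topologicalType) (I I' : Type) (B : I -> set T)
    (B' : I' -> set T') : is_base B -> is_base B' ->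
  is_base (fun i : I * I' => B i.1 `*` B' i.2).
Proof.
move=> [oB bB] [oB' bB']; split=> [i|U [x y] oU Uxy].
  rewrite (_ : _ `*` _ = (fst @^-1` B i.1) `&` (snd @^-1` B' i.2)); last first.
    by apply/seteqP; split=> -[? ?] [].
  by apply: openI; apply: open_comp => // p _; [exact: cvg_fst|exact: cvg_snd].
have [[V V'] /= [xV yV'] VU] := open_nbhs_nbhs (conj oU Uxy).
move: xV yV'; rewrite !nbhsE => -[W [oW Wx] WV] [W' [oW' W'y] WV'].
have [i Bx BW] := bB _ _ oW Wx; have [i' By BW'] := bB' _ _ oW' W'y.
exists (i, i') => //= -[u v] /= [Bu Bv]; apply: VU; split => /=.
  exact/WV/BW.
exact/WV'/BW'.
Qed.

(** An open set is the union of the base sets it contains, a countable union, so Borel measurability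
    has to be tested on the base only. *)
Lemma borel_preimage_base (Omega : pointedType) (M : set (set Omega))
    (T : ptopologicalType) (I : countType) (B : I -> set T) (f : Omega -> T) :
  is_base B -> sigma_algebra setT M -> (forall i, M (f @^-1` B i)) ->
  forall D : set (borel T), measurable D -> M (f @^-1` D).
Proof.
move=> [oB bB] sM MB.
have ME : @measurable _ (g_sigma_algebraType M) = M by exact: sigma_algebra_id.
suff : measurable_fun (setT : set (g_sigma_algebraType M)) (f : _ -> borel T).
  by move=> mf D mD; have := mf measurableT D mD; rewrite setTI ME.
apply: (@measurability _ _ (g_sigma_algebraType M) (borel T) setT f (@open T)) => //.
move=> _ [U oU <-]; rewrite setTI.
rewrite (_ : f @^-1` U = \bigcup_(i in [set i | B i `<=` U]) (f @^-1` B i)).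
  rewrite bigcup_mkcond.
  apply: (@countable_bigcupT_measurable _ (g_sigma_algebraType M) I) => [|i].
    exact: countableP.
  by case: ifPn => _ //; rewrite ME.
apply/seteqP; split=> [w Uw|w [i BU /BU]//].
by have [i Bi BU] := bB _ _ oU Uw; exists i.
Qed.

Lemma CI_set0 (R : realType) d (Omega : measurableType d) (P : probability Omega R)
    (K : finType) (s : K -> set (set Omega)) : (forall k, s k `<=` measurable) ->
  forall S U, CI P s finset.set0 S U.
Proof.
move=> sm S U; apply: CI_sym => //; apply/CIP => // A _.
by rewrite finset.set0U; exact: ae_eq_refl.
Qed.

Section coordinates.
Variables (V : finType) (S : V -> ptopologicalType).

Lemma measurable_coordinate v :
  measurable_fun setT ((fun x => x v) : borel (prod_topology S) -> borel (S v)).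
Proof.
exact: (@continuous_borel_measurable (prod_topology S) (S v) _
  (@coordinate_continuous _ S v)).
Qed.

Lemma measurable_subproj (A : {set V}) :
  measurable_fun setT (subproj A : borel (prod_topology S) -> _).
Proof.
apply: (@continuous_borel_measurable (prod_topology S)
  (prod_topology (fun v : {v : V | v \in A} => S (val v)))).
by apply: prod_topology_continuous => v; exact: coordinate_continuous.
Qed.

Context d (Omega : measurableType d).
Variable X : Omega -> borel (prod_topology S).
Hypothesis mX : measurable_fun setT X.

Definition coord_sigma v : set (set Omega) :=
  sigma_of ((fun w => X w v) : Omega -> borel (S v)).

Lemma measurable_coord v :
  measurable_fun setT ((fun w => X w v) : Omega -> borel (S v)).
Proof. exact: (measurableT_comp (@measurable_coordinate v) mX). Qed.

Lemma coord_sigma_measurable v : coord_sigma v `<=` measurable.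
Proof. exact: (sigma_subalgebra_sigma_of (@measurable_coord v)).2. Qed.

Lemma joint_sigma1 v : joint_sigma coord_sigma [set v]%SET = coord_sigma v.
Proof.
rewrite /joint_sigma (_ : [set` [set v]%SET] = [set v]).
  rewrite bigcup_set1; apply: sigma_algebra_id.
  exact: (sigma_subalgebra_sigma_of (@measurable_coord v)).1.
by apply/seteqP; split=> u /=; rewrite inE => /eqP.
Qed.

Variable B : forall v, nat * nat -> set (S v).
Arguments B : clear implicits.
Hypothesis baseB : forall v, is_base (B v).

(** A base set of a finite product is a finite intersection of coordinate events, so the Borel sets
    of the subproduct yield nothing beyond what its coordinates generate. *)
Lemma joint_sigma_subproj (A : {set V}) :
  sigma_of (fun w => subproj A (X w)) = joint_sigma coord_sigma A.
Proof.
pose J := {v : V | v \in A}.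
apply/seteqP; split.
  move=> _ [D mD <-]; rewrite setTI.
  apply: (borel_preimage_base (prod_base (fun j : J => baseB (val j)))) mD.
    exact: smallest_sigma_algebra.
  move=> c.
  rewrite (_ : _ @^-1` _ = \bigcap_(j in [set: J])
      ((fun w => X w (val j)) @^-1` B (val j) (c j))); last first.
    by apply/seteqP; split=> [w wc j _|w wc j]; [exact: wc|exact: wc j I].
  pose G := \bigcup_(k in [set` A]) coord_sigma k.
  apply: (@fin_bigcap_measurable _ (g_sigma_algebraType G)).
    exact: finite_finset.
  move=> j _; apply: sub_sigma_algebra; exists (val j); first exact: (valP j).
  exists (B (val j) (c j)); last by rewrite setTI.
  apply: sub_sigma_algebra; exact: (baseB (val j)).1.
apply: smallest_sub.
  apply: (sigma_subalgebra_sigma_of _).1.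
  exact: measurableT_comp (@measurable_subproj A) mX.
move=> E [v /= vA [D mD <-]]; pose j : J := exist _ v vA.
exists ((fun x : prod_topology (fun j : J => S (val j)) => x j) @^-1` D) => //.
rewrite -[X in measurable X]setTI.
exact: (@continuous_borel_measurable _ _ _
  (@coordinate_continuous _ (fun j : J => S (val j)) j)).
Qed.

Lemma joint_sigma_setT : sigma_of X = joint_sigma coord_sigma [set: V]%SET.
Proof.
apply/seteqP; split.
  move=> _ [D mD <-]; rewrite setTI.
  apply: (borel_preimage_base (prod_base baseB)) mD.
    exact: smallest_sigma_algebra.
  move=> c.
  rewrite (_ : _ @^-1` _ = \bigcap_(v in [set: V])
      ((fun w => X w v) @^-1` B v (c v))); last first.
    by apply/seteqP; split=> [w wc j _|w wc j]; [exact: wc|exact: wc j I].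
  pose G := \bigcup_(k in [set` [set: V]%SET]) coord_sigma k.
  apply: (@fin_bigcap_measurable _ (g_sigma_algebraType G)).
    exact: finite_finset.
  move=> v _; apply: sub_sigma_algebra; exists v; first by rewrite /= inE.
  exists (B v (c v)); last by rewrite setTI.
  apply: sub_sigma_algebra; exact: (baseB v).1.
apply: smallest_sub; first exact: (sigma_subalgebra_sigma_of mX).1.
move=> E [v /= _ [D mD <-]].
exists ((fun x : prod_topology S => x v) @^-1` D) => //.
rewrite -[X in measurable X]setTI.
exact: measurable_coordinate.
Qed.

Lemma compatible_CI (R : realType) (P : probability Omega R) (F : rel V) :
  compatible P F X <-> (forall i, CI P coord_sigma [set i]%SET
    (~: (i |: descendants F i))%SET (parents F i)).
Proof.
have mXA A : measurable_fun setT (fun w => subproj A (X w)).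
  exact: measurableT_comp (@measurable_subproj A) mX.
split=> cX i.
  have /(cond_indepP P (@measurable_coord i) (mXA _) (mXA _)) := cX i.
  by rewrite !joint_sigma_subproj -/(coord_sigma i) -joint_sigma1.
apply/(cond_indepP P (@measurable_coord i) (mXA _) (mXA _)).
by rewrite !joint_sigma_subproj -/(coord_sigma i) -joint_sigma1; exact: cX.
Qed.

End coordinates.

Lemma compatible_law (R : realType) d (Omega : measurableType d)
    (P : probability Omega R) d' (Omega' : measurableType d')
    (Q : probability Omega' R) (phi : Omega -> Omega') (V : finType) (F : rel V)
    (S : V -> ptopologicalType) (X : Omega' -> borel (prod_topology S)) :
  measurable_fun setT phi ->
  (forall D, measurable D -> Q D = P (phi @^-1` D)) ->
  measurable_fun setT X ->
  compatible Q F X <-> compatible P F (X \o phi).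
Proof.
move=> mphi QE mX.
have mXA A : measurable_fun setT (fun w => subproj A (X w)).
  exact: measurableT_comp (@measurable_subproj _ _ A) mX.
split=> cX i; have := cX i.
  by move/(cond_indep_law mphi QE (measurable_coord mX (v := i)) (mXA _) (mXA _)).
move=> ciP.
by apply/(cond_indep_law mphi QE (measurable_coord mX (v := i)) (mXA _) (mXA _)).
Qed.

(** * Gluing causal couplings *)

Lemma descendants_trans (V : finType) (E : rel V) (i : V) : transitive E ->
  descendants E i = [set j | E i j]%SET.
Proof.
move=> trE; apply/setP => j; rewrite !inE.
apply/existsP/idP => [[k /andP[ik kj]]|ij]; last first.
  by exists j; rewrite ij connect0.
case/connectP: kj => p; elim: p i k ik => [|l p IH] i k ik /=.
  by move=> _ ->.
by move=> /andP[kl pp] e; apply: (IH i l) pp e; exact: trE ik kl.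
Qed.

Lemma causal_graph_trans (V : finType) (E : rel V) :
  transitive E -> transitive (causal_graph E).
Proof.
move=> trE [y|y] [x|x] [z|z] //=; try exact: trE.
- by move=> xy /orP[yz|/eqP<-]; rewrite ?xy// (trE _ _ _ xy yz).
- by move=> /orP[xy|/eqP->] yz; rewrite ?yz// (trE _ _ _ xy yz).
Qed.

Section causal_pairs.
Variables (V L : finType) (E : rel V).
Hypothesis trE : transitive E.

Definition to_layers (a b : L) (v : V + V) : L * V :=
  match v with inl v => (a, v) | inr v => (b, v) end.

Lemma imset_to_layers a b (S : {set V + V}) :
  to_layers a b @: S = (layer a [set v | inl v \in S] :|:
    layer b [set v | inr v \in S])%SET.
Proof.
apply/setP => -[l v]; rewrite !inE /=; apply/imsetP/idP => [[[u|u] uS [-> ->]]|].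
- by rewrite eqxx uS.
- by rewrite eqxx uS orbT.
by move=> /orP[]/andP[/eqP-> vS]; [exists (inl v)|exists (inr v)].
Qed.

Lemma joint_sigma_imset d (Omega : measurableType d) (I J : finType) (f : I -> J)
    (s : J -> set (set Omega)) (S : {set I}) :
  joint_sigma (s \o f) S = joint_sigma s (f @: S)%SET.
Proof.
rewrite /joint_sigma; congr <<s _ >>; apply/seteqP.
split=> [A [i /= iS siA]|A [_ /imsetP[i iS ->] siA]]; last by exists i.
by exists (f i) => //; exact: imset_f.
Qed.

(** [causal_graph E] inherits transitivity, so its descendants are its children, and the parents and
    non-descendants of [inl i] and [inr i] can be listed layer by layer. *)
Lemma causal_layersP (ci : {set L * V} -> {set L * V} -> {set L * V} -> Prop) a b :
  (forall v, ci (to_layers a b @: [set v])%SET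
    (to_layers a b @: ~: (v |: descendants (causal_graph E) v))%SET
    (to_layers a b @: parents (causal_graph E) v)%SET) <->
  causal_layers E ci a b.
Proof.
have dE v := descendants_trans v (causal_graph_trans trE).
have e1 i : (to_layers a b @: [set inl i] = layer a [set i])%SET.
  by rewrite imset_set1; apply/setP => -[l v]; rewrite !inE.
have e1' i : (to_layers a b @: [set inr i] = layer b [set i])%SET.
  by rewrite imset_set1; apply/setP => -[l v]; rewrite !inE.
have e2 i : (to_layers a b @: (~: (inl i |: descendants (causal_graph E) (inl i))) =
    layer a (nondsc E i) :|: layer b (nondsc E i))%SET.
  rewrite imset_to_layers dE; congr (layer _ _ :|: layer _ _); apply/setP => v.
    by rewrite !inE.
  by rewrite !inE /= (eq_sym v) orbC.
have e2' i : (to_layers a b @: (~: (inr i |: descendants (causal_graph E) (inr i))) =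
    layer a [set: V] :|: layer b (nondsc E i))%SET.
  by rewrite imset_to_layers dE; congr (layer _ _ :|: layer _ _); apply/setP => v;
    rewrite !inE.
have e3 i : (to_layers a b @: parents (causal_graph E) (inl i) =
    layer a (parents E i))%SET.
  rewrite imset_to_layers -[RHS]finset.setU0; congr (_ :|: _)%SET.
    by congr layer; apply/setP => v; rewrite !inE.
  by apply/setP => -[l v]; rewrite !inE andbF.
have e3' i : (to_layers a b @: parents (causal_graph E) (inr i) =
    layer a (i |: parents E i) :|: layer b (parents E i))%SET.
  rewrite imset_to_layers; congr (layer _ _ :|: layer _ _); apply/setP => v.
    by rewrite !inE /= orbC.
  by rewrite !inE.
split=> [cc i|cl [i|i]].
- have h := cc (inl i); have h' := cc (inr i).
  by rewrite e1 e2 e3 in h; rewrite e1' e2' e3' in h'.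
- by rewrite e1 e2 e3; exact: (cl i).1.
- by rewrite e1' e2' e3'; exact: (cl i).2.
Qed.

End causal_pairs.

Lemma joint_measurable (V : finType) (X Y : V -> ptopologicalType) :
  measurable_fun setT (@join V X Y :
    borel (prod_topology X * prod_topology Y) -> borel (prod_topology (sum_spaces X Y))).
Proof.
apply: (@continuous_borel_measurable (prod_topology X * prod_topology Y)%type
  (prod_topology (sum_spaces X Y))).
apply: prod_topology_continuous => -[v|v] p.
  exact: (cvg_comp fst (fun x : prod_topology X => x v) cvg_fst
    (@coordinate_continuous _ X v _)).
exact: (cvg_comp snd (fun x : prod_topology Y => x v) cvg_snd
  (@coordinate_continuous _ Y v _)).
Qed.

(** * Three processes on a common probability space *)

Section three_processes.
Context (R : realType) d (Omega : measurableType d) (P : probability Omega R).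
Variables (V L : finType) (E : rel V).
Hypotheses (irrE : irreflexive E) (trE : transitive E).
Variable S : L -> V -> ptopologicalType.
Variable W : forall a, Omega -> borel (prod_topology (S a)).
Hypothesis mW : forall a, measurable_fun setT (W a).
Variable B : forall a v, nat * nat -> set (S a v).
Arguments B : clear implicits.
Hypothesis baseB : forall a v, is_base (B a v).

Definition pair_join a b (w : Omega) :
    borel (prod_topology (sum_spaces (S a) (S b))) :=
  join (W a w, W b w).

Let s (p : L * V) : set (set Omega) := coord_sigma (W p.1) p.2.

Let sm p : s p `<=` measurable.
Proof. exact: coord_sigma_measurable. Qed.

Lemma measurable_pair_join a b : measurable_fun setT (pair_join a b).
Proof.
suff : measurable_fun setT (fun w => (W a w, W b w) : borel (_ * _)).
  by move=> m; exact: (measurableT_comp (@joint_measurable _ _ _) m).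
move=> _ D mD; rewrite setTI.
apply: (borel_preimage_base (pair_base (prod_base (baseB a)) (prod_base (baseB b)))) mD.
  exact: sigma_algebra_measurable.
move=> i.
rewrite (_ : _ @^-1` _ = (W a @^-1` [set x | forall j, B a j (i.1 j) (x j)]) `&`
  (W b @^-1` [set x | forall j, B b j (i.2 j) (x j)]))//.
by apply: measurableI; rewrite -[X in measurable X]setTI; apply: (mW measurableT);
  apply: sub_sigma_algebra; exact: (prod_base (@baseB _)).1.
Qed.

Lemma compatible_causal_layers a b :
  compatible P (causal_graph E) (pair_join a b) <->
  causal_layers E (CI P s) a b.
Proof.
pose BB (v : V + V) : nat * nat -> set (sum_spaces (S a) (S b) v) :=
  match v with inl v => B a v | inr v => B b v end.
have baseBB v : is_base (BB v) by case: v => v; exact: baseB.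
apply: iff_trans (compatible_CI (@measurable_pair_join a b) baseBB P _) _.
apply: iff_trans _ (causal_layersP trE _ a b).
have -> : coord_sigma (pair_join a b) = s \o to_layers a b.
  by apply/funext => -[v|v].
by split=> h v; have := h v; rewrite /CI !joint_sigma_imset.
Qed.

Lemma joint_sigma_layer a : joint_sigma s (layer a finset.setT) = sigma_of (W a).
Proof.
rewrite (joint_sigma_setT (@mW a) (baseB a)) /joint_sigma; congr <<s _ >>.
apply/seteqP; split=> [A [[l v] /= + slA]|A [v _ svA]].
  by rewrite !inE andbT /= => /eqP e; subst l; exists v => //=; rewrite inE.
by exists (a, v) => //=; rewrite !inE eqxx.
Qed.

Lemma compatible_glue a b c : has_no_splits E ->
  compatible P (causal_graph E) (pair_join a b) ->
  compatible P (causal_graph E) (pair_join b c) ->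
  (forall A C, sigma_of (W a) A -> sigma_of (W c) C ->
    indep P (sigma_of (W b)) A C) ->
  compatible P (causal_graph E) (pair_join a c).
Proof.
move=> nosplit /compatible_causal_layers cab /compatible_causal_layers cbc glue.
apply/compatible_causal_layers; apply: (causal_layers_trans irrE trE _ _ _ _ cab cbc).
- by move=> ? ? ?; exact: CI_sym.
- by move=> ? ? ? ?; exact: CI_contraction.
- by move=> ? ? ? ? ? ?; exact: CI_weak_union.
- by move=> ? ?; exact: CI_set0.
- by move=> A C; rewrite !joint_sigma_layer; exact: glue.
- exact: nosplit.
Qed.

End three_processes.

(** * Borel products, disintegrations and the conditional independent product *)

Section borel_products.
Variables A B : ptopologicalType.

Lemma measurable_borel_fst :
  measurable_fun setT (fst : borel (A * B) -> borel A).
Proof.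
by apply: (@continuous_borel_measurable (A * B)%type A) => p; exact: cvg_fst.
Qed.

Lemma measurable_borel_snd :
  measurable_fun setT (snd : borel (A * B) -> borel B).
Proof.
by apply: (@continuous_borel_measurable (A * B)%type B) => p; exact: cvg_snd.
Qed.

Lemma measurable_borel_fst_preimage (D : set (borel A)) :
  measurable D -> measurable (fst @^-1` D : set (borel (A * B))).
Proof.
by move=> mD; rewrite -[X in measurable X]setTI; exact: measurable_borel_fst.
Qed.

Lemma measurable_borel_snd_preimage (D : set (borel B)) :
  measurable D -> measurable (snd @^-1` D : set (borel (A * B))).
Proof.
by move=> mD; rewrite -[X in measurable X]setTI; exact: measurable_borel_snd.
Qed.

Lemma measurable_borel_rect (D : set (borel A)) (D' : set (borel B)) :
  measurable D -> measurable D' ->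
  measurable (fst @^-1` D `&` snd @^-1` D' : set (borel (A * B))).
Proof.
by move=> mD mD'; apply: measurableI;
  [exact: measurable_borel_fst_preimage|exact: measurable_borel_snd_preimage].
Qed.

Lemma borel_prodE (I J : countType) (BA : I -> set A) (BB : J -> set B) :
  is_base BA -> is_base BB ->
  @measurable _ (borel (A * B)) = <<s [set fst @^-1` D `&` snd @^-1` D' |
    D in @measurable _ (borel A) & D' in @measurable _ (borel B)] >>.
Proof.
move=> bA bB; apply/seteqP; split=> [D|].
  rewrite -{2}(preimage_id D); apply: (borel_preimage_base (pair_base bA bB)).
    exact: smallest_sigma_algebra.
  move=> i; apply: sub_sigma_algebra.
  exists (BA i.1); first by apply: sub_sigma_algebra; exact: bA.1.
  by exists (BB i.2); first by apply: sub_sigma_algebra; exact: bB.1.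
apply: smallest_sub; first exact: sigma_algebra_measurable.
by move=> _ [D mD] [D' mD'] <-; exact: measurable_borel_rect.
Qed.

Lemma borel_prod_measurable_fun (I J : countType) (BA : I -> set A)
    (BB : J -> set B) d (Omega : measurableType d) (f : Omega -> borel A)
    (g : Omega -> borel B) :
  is_base BA -> is_base BB -> measurable_fun setT f -> measurable_fun setT g ->
  measurable_fun setT (fun w => (f w, g w) : borel (A * B)).
Proof.
move=> bA bB mf mg _ D mD; rewrite setTI.
apply: (borel_preimage_base (pair_base bA bB)) mD.
  exact: sigma_algebra_measurable.
move=> i; apply: measurableI.
  rewrite -[X in measurable X]setTI; apply: mf => //.
  by apply: sub_sigma_algebra; exact: bA.1.
rewrite -[X in measurable X]setTI; apply: mg => //.
by apply: sub_sigma_algebra; exact: bB.1.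
Qed.

End borel_products.

Section disintegration.
Context (R : realType) (A C : ptopologicalType).
Variables (p : probability (borel (A * C)) R) (m : probability (borel A) R).
Local Open Scope ereal_scope.

Lemma disintegrates_rect (k : borel A -> {measure set (borel C) -> \bar R})
    (D : set (borel A)) (C' : set (borel C)) :
  disintegrates p m k -> measurable D -> measurable C' ->
  p (fst @^-1` D `&` snd @^-1` C') = \int[m]_(a in D) k a C'.
Proof.
move=> pk mD mC'; rewrite pk; last exact: measurable_borel_rect.
rewrite [RHS]integral_mkcond; apply: eq_integral => a _; rewrite patchE.
have [aD|aD] := boolP (a \in D).
  congr (k a _); apply/seteqP; split=> [c /xsectionP[]//|c C'c].
  by apply/xsectionP; split => //=; rewrite inE in aD.
rewrite (_ : xsection _ _ = set0) ?measure0//.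
apply/seteqP; split=> // c /xsectionP[/= Da _].
by move: aD; rewrite notin_setE.
Qed.

Lemma disintegrates_fst (k : borel A -> {measure set (borel C) -> \bar R})
    (D : set (borel A)) :
  (forall a, k a setT = 1) -> disintegrates p m k -> measurable D ->
  p (fst @^-1` D) = m D.
Proof.
move=> k1 pk mD.
rewrite -[X in p X]setIT -(preimage_setT snd) (disintegrates_rect pk)//.
under eq_integral do rewrite k1.
by rewrite integral_cst// mul1e.
Qed.

End disintegration.

Section cond_indep_product.
Context (R : realType) (A B C : ptopologicalType).
Variables (I J : countType) (BB : I -> set B) (BC : J -> set C).
Hypotheses (bB : is_base BB) (bC : is_base BC).
Variables (nu : probability (borel B) R)
  (pi1 : probability (borel (A * B)) R) (pi2 : probability (borel (B * C)) R)
  (rho : probability (borel (A * B * C)) R).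
Hypothesis pi1_nu : forall D : set (borel B), measurable D -> pi1 (snd @^-1` D) = nu D.
Variable kappa : R.-pker (borel B) ~> (borel C).
Hypotheses (pi2_kappa : disintegrates pi2 nu kappa)
  (rho_kappa : disintegrates rho pi1 (fun ab => kappa ab.2)).
Local Open Scope ereal_scope.

Let XY : borel (A * B * C) -> borel (A * B) := fst.
Let X : borel (A * B * C) -> borel A := fst \o XY.
Let Y : borel (A * B * C) -> borel B := snd \o XY.
Let Z : borel (A * B * C) -> borel C := snd.

Let mXY : measurable_fun setT XY. Proof. exact: measurable_borel_fst. Qed.
Let mX : measurable_fun setT X.
Proof. exact: (measurableT_comp (@measurable_borel_fst A B) mXY). Qed.
Let mY : measurable_fun setT Y.
Proof. exact: (measurableT_comp (@measurable_borel_snd A B) mXY). Qed.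
Let mZ : measurable_fun setT Z. Proof. exact: measurable_borel_snd. Qed.

Lemma product_law12 D : measurable D -> pi1 D = rho (XY @^-1` D).
Proof.
move=> mD; rewrite (disintegrates_fst _ rho_kappa)// => ab.
exact: prob_kernel.
Qed.

Let mkappa C' : measurable C' -> measurable_fun setT (kappa ^~ C').
Proof. by move=> mC'; exact: measurable_kernel. Qed.

Lemma product_law23 D : measurable D -> pi2 D = rho ((fun w => (Y w, Z w)) @^-1` D).
Proof.
have mYZ := borel_prod_measurable_fun bB bC mY mZ.
pose YZm := isMeasurableFun.Build _ _ _ _ _ mYZ.
pose YZ : {mfun borel (A * B * C) >-> borel (B * C)} :=
  HB.pack (fun w => (Y w, Z w) : borel (B * C)) YZm.
pose m2 := distribution rho YZ.
move=> mD; change (pi2 D = m2 D); move: D mD.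
(* Rectangles determine both laws. On a rectangle each is the integral of the same function of b,
   against [nu] on one side and against [pi1] on the other; the B-marginal of [pi1] is [nu]. *)
apply: (@measure_unique _ R (borel (B * C)) [set fst @^-1` D `&` snd @^-1` D' |
    D in @measurable _ (borel B) & D' in @measurable _ (borel C)] (fun=> setT)).
- exact: borel_prodE bB bC.
- move=> _ _ [D1 mD1] [D2 mD2] <- [D3 mD3] [D4 mD4] <-.
  exists (D1 `&` D3); first exact: measurableI.
  exists (D2 `&` D4); first exact: measurableI.
  by rewrite !preimage_setI setIACA.
- by move=> _; exists setT => //; exists setT => //; rewrite setIT.
- by apply/seteqP; split=> // w _; exists 0%N.
- move=> _ [B' mB'] [C' mC'] <-.
  apply: etrans (disintegrates_rect pi2_kappa mB' mC') _.
  have mB'' := @measurable_borel_snd_preimage A _ _ mB'.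
  apply: etrans _ (esym (disintegrates_rect rho_kappa mB'' mC')).
  have nuE D : measurable D -> nu D = pi1 (snd @^-1` D) by move=> /pi1_nu.
  apply: (ge0_integral_law (@measurable_borel_snd A B) nuE) => //.
  exact: mkappa.
- by move=> _; rewrite ltey_eq (fin_num_measure pi2).
Qed.

(** The kernel is an explicit version of the conditional law of Z given Y. Its integrals are right
    over all events of (X, Y), not only over those of Y, and this is the independence. *)
Lemma product_indep D D' : sigma_of X D -> sigma_of Z D' ->
  indep rho (sigma_of Y) D D'.
Proof.
have sY := sigma_subalgebra_sigma_of mY.
move=> [A' mA' <-] [C' mC' <-]; rewrite !setTI.
have mXA' : measurable (X @^-1` A').
  by rewrite -[X in measurable X]setTI; exact: mX.
have mZC' : measurable (Z @^-1` C').
  by rewrite -[X in measurable X]setTI; exact: mZ.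
apply: (indep_sym sY mZC' mXA').
have rhoE E : measurable E ->
    rho (XY @^-1` E `&` Z @^-1` C') = \int[rho]_(w in XY @^-1` E) kappa (Y w) C'.
  move=> mE; rewrite (disintegrates_rect rho_kappa)//.
  apply: (ge0_integral_law mXY product_law12) => //.
  exact: (measurableT_comp (mkappa mC') (@measurable_borel_snd A B)).
pose g w := fine (kappa (Y w) C').
have k1 b : kappa b setT = 1 by exact: prob_kernel.
have kfin b : kappa b C' \is a fin_num.
  rewrite ge0_fin_numE//; apply: le_lt_trans (ltry 1).
  by rewrite -(k1 b) le_measure ?inE.
have mg : measurable_fun setT g.
  apply: measurableT_comp => //.
  exact: (measurableT_comp (mkappa mC') mY).
have gE w : (g w)%:E = kappa (Y w) C' by rewrite fineK.
have cpE : ae_eq rho setT (EFin \o cp rho (sigma_of Y) (Z @^-1` C')) (EFin \o g).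
  apply: cp_unique => //.
  - move=> _ E mE; rewrite (trace_measurableE sY) setTI.
    exists ((fun b => fine (kappa b C')) @^-1` E); last by rewrite setTI.
    rewrite -[X in measurable X]setTI.
    by apply: measurableT_comp => //; exact: mkappa.
  - apply: (@le_integrable _ _ _ _ _ _ _ (cst 1)) => //.
    + exact/measurable_EFinP.
    + move=> w _; change (`|(g w)%:E| <= `|1%:E : \bar R|).
      rewrite gE gee0_abs// abse1 -(k1 (Y w)).
      by rewrite le_measure ?inE.
    + by apply: finite_measure_integrable_cst.
  - move=> _ [B' mB' <-]; rewrite setTI.
    under eq_integral do rewrite gE.
    rewrite setIC -(rhoE (snd @^-1` B'))//.
    exact: measurable_borel_snd_preimage.
move=> _ [B' mB' <-]; rewrite setTI.
have mXY' : measurable (fst @^-1` A' `&` snd @^-1` B' : set (borel (A * B))).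
  exact: measurable_borel_rect.
have mXYB : measurable (X @^-1` A' `&` Y @^-1` B').
  by rewrite -[X in measurable X]setTI; exact: (mXY measurableT mXY').
transitivity (\int[rho]_(w in X @^-1` A' `&` Y @^-1` B') (g w)%:E).
  apply: ae_eq_integral => //.
  - apply/measurable_EFinP/measurable_funTS/measurable_cp => //.
  - by apply/measurable_EFinP/measurable_funTS.
  - exact: ae_eq_subset cpE.
under eq_integral do rewrite gE.
rewrite -setIA (setIC (Z @^-1` C')); exact: esym (rhoE _ mXY').
Qed.

End cond_indep_product.

(** * Transitive graphs without splits have both gluing properties *)

Section sufficiency.
Variables (R : realType) (V : finType) (E : rel V).
Hypotheses (irrE : irreflexive E) (trE : transitive E) (nosplitE : has_no_splits E).
Variables X Y Z : V -> ptopologicalType.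
Hypotheses (pX : forall v, polish R (X v)) (pY : forall v, polish R (Y v))
  (pZ : forall v, polish R (Z v)).
Variables (mu : probability (borel (prod_topology X)) R)
  (nu : probability (borel (prod_topology Y)) R)
  (eta : probability (borel (prod_topology Z)) R)
  (pi : probability (borel (prod_topology X * prod_topology Y)) R)
  (pi' : probability (borel (prod_topology Y * prod_topology Z)) R)
  (gamma : probability (borel (prod_topology X * prod_topology Z)) R).
Hypotheses (cpi : is_coupling mu nu pi) (cpi' : is_coupling nu eta pi')
  (glue : is_gluing nu pi pi' gamma).

Let T := borel (prod_topology X * prod_topology Y * prod_topology Z).

Let S (a : option bool) : V -> ptopologicalType :=
  match a with None => X | Some false => Y | Some true => Z end.

Let W (a : option bool) : T -> borel (prod_topology (S a)) :=
  match a with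
  | None => fun w => w.1.1
  | Some false => fun w => w.1.2
  | Some true => fun w => w.2
  end.

Let mW a : measurable_fun setT (W a).
Proof.
case: a => [[]|].
- exact: measurable_borel_snd.
- exact: (measurableT_comp (@measurable_borel_snd _ _) (@measurable_borel_fst _ _)).
- exact: (measurableT_comp (@measurable_borel_fst _ _) (@measurable_borel_fst _ _)).
Qed.

Let bases : exists B : forall a v, nat * nat -> set (S a v),
  forall a v, is_base (B a v).
Proof.
have pS a v : polish R (S a v) by case: a => [[]|].
exists (fun a v => sval (cid (polish_base (pS a v)))) => a v.
exact: (svalP (cid (polish_base (pS a v)))).
Qed.

Let joint_law : exists rho : probability T R,
  [/\ forall D, measurable D ->
        pi D = rho ((fun w => (W None w, W (Some false) w)) @^-1` D),
      forall D, measurable D ->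
        pi' D = rho ((fun w => (W (Some false) w, W (Some true) w)) @^-1` D),
      forall D, measurable D ->
        gamma D = rho ((fun w => (W None w, W (Some true) w)) @^-1` D) &
      forall D D', sigma_of (W None) D -> sigma_of (W (Some true)) D' ->
        indep rho (sigma_of (W (Some false))) D D'].
Proof.
have [B bB] := bases; have [rho [kappa [pik rhok]] gammaE] := glue.
have bY : is_base _ := prod_base (bB (Some false)).
have bZ : is_base _ := prod_base (bB (Some true)).
exists rho; split => //.
- move=> D mD; rewrite (product_law12 rhok mD); congr (rho _).
  by apply/seteqP; split=> -[[x y] z].
- by move=> D mD; exact: (product_law23 bY bZ cpi.2 pik rhok).
- by move=> D D'; exact: (product_indep rhok).
Qed.

Let measurable_pairW a b :
  measurable_fun setT ((fun w => (W a w, W b w)) :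
    T -> borel (prod_topology (S a) * prod_topology (S b))).
Proof.
have [B bB] := bases.
exact: (borel_prod_measurable_fun (prod_base (bB a)) (prod_base (bB b)) (@mW a) (@mW b)).
Qed.

Let compatible_pairW (rho : probability T R) a b
    (q : probability (borel (prod_topology (S a) * prod_topology (S b))) R) :
  (forall D, measurable D -> q D = rho ((fun w => (W a w, W b w)) @^-1` D)) ->
  compatible q (causal_graph E) (@join V (S a) (S b)) <->
  compatible rho (causal_graph E) (pair_join W a b).
Proof.
move=> qE.
exact: (compatible_law _ (@measurable_pairW a b) qE (@joint_measurable _ _ _)).
Qed.

Lemma coupling_glue : is_coupling mu eta gamma.
Proof.
have [rho [piE pi'E gammaE _]] := joint_law.
split=> D mD.
  rewrite gammaE; last exact: measurable_borel_fst_preimage.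
  by rewrite -cpi.1// piE//; exact: measurable_borel_fst_preimage.
rewrite gammaE; last exact: measurable_borel_snd_preimage.
by rewrite -cpi'.2// pi'E//; exact: measurable_borel_snd_preimage.
Qed.

Lemma causal_glue : causal_coupling E mu nu pi -> causal_coupling E nu eta pi' ->
  causal_coupling E mu eta gamma.
Proof.
move=> [_ cXY] [_ cYZ]; split; first exact: coupling_glue.
have [rho [piE pi'E gammaE iXZ]] := joint_law; have [B bB] := bases.
apply/(compatible_pairW (a := None) (b := Some true) gammaE).
apply: (compatible_glue irrE trE mW bB nosplitE _ _ iXZ).
- exact/(compatible_pairW (a := None) (b := Some false) piE).
- exact/(compatible_pairW (a := Some false) (b := Some true) pi'E).
Qed.

(** The same glued space with the layers X and Z exchanged: the swap is absorbed by the order of the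
    pair, and independence given Y is symmetric. *)
Lemma anticausal_glue : anticausal_coupling E mu nu pi ->
  anticausal_coupling E nu eta pi' -> anticausal_coupling E mu eta gamma.
Proof.
move=> [_ [_ cYX]] [_ [_ cZY]]; split; first exact: coupling_glue.
have mswap (A B : ptopologicalType) (D : set (borel (B * A))) : measurable D ->
    measurable (@swap A B @^-1` D).
  move=> mD; rewrite -[X in measurable X]setTI.
  exact: (@Defs.measurable_swap A B measurableT).
have [gX gZ] := coupling_glue.
split; first by split=> D mD; [exact: gZ|exact: gX].
have [rho [piE pi'E gammaE iXZ]] := joint_law; have [B bB] := bases.
apply/(compatible_pairW (rho := rho) (a := Some true) (b := None)).
  by move=> D mD; exact: gammaE (mswap _ _ _ mD).
apply: (compatible_glue irrE trE mW bB nosplitE (b := Some false)).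
- apply: (iffLR (compatible_pairW (rho := rho) (a := Some true) (b := Some false) _) cZY).
  by move=> D mD; exact: pi'E (mswap _ _ _ mD).
- apply: (iffLR (compatible_pairW (rho := rho) (a := Some false) (b := None) _) cYX).
  by move=> D mD; exact: piE (mswap _ _ _ mD).
- move=> D D' ZD XD'; apply: indep_sym; last exact: iXZ.
  + exact: (sigma_subalgebra_sigma_of (@mW (Some false))).
  + exact: (sigma_subalgebra_sigma_of (@mW None)).2.
  + exact: (sigma_subalgebra_sigma_of (@mW (Some true))).2.
Qed.

End sufficiency.

(** * Processes driven by three fair bits *)

Definition bits : Type := g_sigma_algebraType [set: set (bool * bool * bool)].
HB.instance Definition _ := Measurable.on bits.

Lemma measurable_bits (A : set bits) : measurable A.
Proof. exact: sub_sigma_algebra. Qed.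

Lemma measurable_fun_bits d (T : measurableType d) (f : bits -> T) :
  measurable_fun setT f.
Proof. by move=> _ B _; exact: measurable_bits. Qed.



Definition all_bits : seq (bool * bool * bool) :=
  [:: (false, false, false); (false, false, true); (false, true, false);
      (false, true, true); (true, false, false); (true, false, true);
      (true, true, false); (true, true, true)].

Lemma mem_all_bits w : w \in all_bits.
Proof. by case: w => [[[] []] []]. Qed.

Definition flip_bits (t w : bool * bool * bool) : bool * bool * bool :=
  (t.1.1 (+) w.1.1, t.1.2 (+) w.1.2, t.2 (+) w.2).

Lemma perm_flip_bits t : perm_eq (map (flip_bits t) all_bits) all_bits.
Proof. by case: t => [[[] []] []]. Qed.

Section fair_bits.
Variable R : realType.
Local Open Scope ereal_scope.

Let eighth_ge0 : (0 <= 8^-1 :> R)%R. Proof. by rewrite invr_ge0 ler0n. Qed.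

Definition fair_bits : set bits -> \bar R :=
  mscale (NngNum eighth_ge0)
    (msum (fun k => \d_(nth (false, false, false) all_bits k : bits)) 8).

HB.instance Definition _ := Measure.on fair_bits.

Let fair_bitsE (A : set bits) :
  fair_bits A = (8^-1)%:E * \sum_(w <- all_bits) (\1_A w)%:E.
Proof.
rewrite /fair_bits/= /mscale /msum /= (big_nth (false, false, false)) big_mkord.
by congr (_ * _); apply: eq_bigr => k _; rewrite diracE indicE.
Qed.

Let fair_bitsT : fair_bits setT = 1.
Proof.
rewrite fair_bitsE /all_bits !big_cons big_nil !indicT /= -!EFinD -EFinM.
by congr EFin; field.
Qed.

HB.instance Definition _ :=
  Measure_isProbability.Build _ _ _ fair_bits fair_bitsT.

Lemma fair_bits_flip t (A : set bits) :
  fair_bits (flip_bits t @^-1` A) = fair_bits A.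
Proof.
rewrite !fair_bitsE; congr (_ * _).
by rewrite -[RHS](perm_big _ (perm_flip_bits t)) big_map.
Qed.

(** The translation preserves the uniform law and exchanges the two parts into which [A] cuts [M],
    so these have equal mass. *)
Lemma fair_bits_half t (A M : set bits) : flip_bits t @^-1` A = ~` A ->
  flip_bits t @^-1` M = M -> fair_bits (A `&` M) = (2^-1)%:E * fair_bits M.
Proof.
move=> At Mt; have e : fair_bits (A `&` M) = fair_bits (~` A `&` M).
  by rewrite -(fair_bits_flip t (A `&` M)) preimage_setI At Mt.
have -> : fair_bits M = fair_bits (A `&` M) + fair_bits (A `&` M).
  rewrite [X in _ = _ + X]e -measureU.
  - by rewrite -setIUl setUv setTI.
  - exact: measurable_bits.
  - exact: measurable_bits.
  - by rewrite setIACA setICr set0I.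
have : fair_bits (A `&` M) \is a fin_num.
  by rewrite fin_num_measure//; exact: measurable_bits.
move/fineK <-; rewrite -EFinD -EFinM; congr EFin.
by field.
Qed.

End fair_bits.

Section cond_indep_criteria.
Context (R : realType) d (Omega : measurableType d) (P : probability Omega R).
Context d1 d2 d3 (T1 : measurableType d1) (T2 : measurableType d2)
  (T3 : measurableType d3).
Variables (X : Omega -> T1) (Y : Omega -> T2) (Z : Omega -> T3).
Hypotheses (mX : measurable_fun setT X) (mY : measurable_fun setT Y)
  (mZ : measurable_fun setT Z).
Local Open Scope ereal_scope.

Let sZ := sigma_subalgebra_sigma_of mZ.

Lemma cond_indep_function : sigma_of X `<=` sigma_of Z -> cond_indep P X Y Z.
Proof.
move=> XZ; apply/cond_indepP => // A B XA YB.
have mA := sZ.2 _ (XZ _ XA); have mB := (sigma_subalgebra_sigma_of mY).2 _ YB.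
apply: indep_sym => // C ZC; rewrite integral_cp// ?setIA//.
have := @measurableI _ (g_sigma_algebraType (sigma_of Z)) A C.
by rewrite (trace_measurableE sZ); apply => //; exact: XZ.
Qed.

Lemma cp_cst A (r : R) : measurable A ->
  (forall C, sigma_of Z C -> P (A `&` C) = r%:E * P C) ->
  ae_eq P setT (EFin \o cp P (sigma_of Z) A) (EFin \o cst r).
Proof.
move=> mA Ar; apply: cp_unique => //.
- exact: finite_measure_integrable_cst.
- by move=> C ZC; rewrite Ar// -integral_cst//; exact: sZ.2.
Qed.

(** The hypothesis makes X independent of the pair (Y, Z), so P(A | Z) is the constant [r A]. *)
Lemma cond_indep_product (r : set Omega -> R) :
  (forall A B C, sigma_of X A -> sigma_of Y B -> sigma_of Z C ->
    P (A `&` (B `&` C)) = (r A)%:E * P (B `&` C)) -> cond_indep P X Y Z.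
Proof.
move=> AE; apply/cond_indepP => // A B XA YB C ZC.
have mA := (sigma_subalgebra_sigma_of mX).2 _ XA.
have mB := (sigma_subalgebra_sigma_of mY).2 _ YB.
have mBC : measurable (B `&` C) by apply: measurableI => //; exact: sZ.2.
rewrite -setIA (AE _ _ _ XA YB ZC) -integral_cst//.
have YT : sigma_of Y setT by exists setT => //; rewrite setTI preimage_setT.
apply: ae_eq_integral => //.
- by apply/measurable_EFinP/measurable_funTS; exact: measurable_cp.
- have Ar C' : sigma_of Z C' -> P (A `&` C') = (r A)%:E * P C'.
    by move=> ZC'; have := AE _ _ _ XA YT ZC'; rewrite setTI.
  exact: ae_eq_subset (cp_cst mA Ar).
Qed.

(** The event is a function of X and of Y, yet a fair coin given Z. Independence of [A] from itself
    would give P(A) = P(A)/2, against P(A) = 1/2. *)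
Lemma not_cond_indep A : sigma_of X A -> sigma_of Y A ->
  (forall C, sigma_of Z C -> P (A `&` C) = (2^-1)%:E * P C) ->
  ~ cond_indep P X Y Z.
Proof.
move=> XA YA Ahalf /(cond_indepP P mX mY mZ)/(_ _ _ XA YA).
have ZT : sigma_of Z setT by exists setT => //; rewrite setTI preimage_setT.
have mA := (sigma_subalgebra_sigma_of mX).2 _ XA.
move=> /(_ _ ZT); rewrite !setIT setIid.
have := Ahalf _ ZT; rewrite setIT probability_setT mule1 => PA.
rewrite (@ae_eq_integral _ _ _ _ _ (EFin \o cst (2^-1)%R))//; last 3 first.
- by apply/measurable_EFinP/measurable_funTS; exact: measurable_cp.
- exact/measurable_EFinP/measurable_funTS/measurable_cst.
- exact: ae_eq_subset (cp_cst mA Ahalf).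
have -> : \int[P]_(w in A) (EFin \o cst (2^-1)%R) w = (2^-1)%:E * P A.
  exact: (integral_cst P mA (2^-1)%:E).
rewrite PA -EFinM => -[] /eqP; apply/negP.
by rewrite lt_eqF// -[ltRHS]mulr1 ltr_pM2l ?invr_gt0// invf_lt1// ltr1n.
Qed.

End cond_indep_criteria.

(** * Discrete spaces and Markov conditions for bit-valued processes *)

Definition all_open (T : topologicalType) : Prop := forall A : set T, open A.

Lemma all_open_bool : all_open bool.
Proof.
move=> A; rewrite openE => x Ax.
by rewrite /interior nbhs_principalE; exact/principal_filterP.
Qed.

Lemma all_open_prod (J : finType) (S : J -> topologicalType) :
  (forall j, all_open (S j)) -> all_open (prod_topology S).
Proof.
move=> oS A; rewrite openE => x Ax; rewrite /interior.
have : \forall y \near x, forall j, y j = x j.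
  apply: (filter_forall (nbhs_filter x)) => j.
  apply: (@coordinate_continuous _ S j x [set z | z = x j]).
  by apply: open_nbhs_nbhs; split; first exact: oS.
by apply: filterS => y yx; rewrite (_ : y = x)//; apply: functional_extensionality_dep.
Qed.

Lemma all_open_pair (T T' : topologicalType) :
  all_open T -> all_open T' -> all_open (T * T')%type.
Proof.
move=> oT oT' A; rewrite openE => -[x y] Axy; rewrite /interior.
exists ([set x], [set y]) => /=.
  by split; apply: open_nbhs_nbhs; split; [exact: oT| |exact: oT'|].
by move=> [x' y'] /= [-> ->].
Qed.

Lemma all_open_measurable (T : ptopologicalType) (A : set (borel T)) :
  all_open T -> measurable A.
Proof. by move=> oT; apply: sub_sigma_algebra; exact: oT. Qed.

Lemma polish_bool (R : realType) : polish R bool.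
Proof.
split.
  exists setT; first exact: countableP.
  by move=> U [x Ux] _; exists x.
exists (fun x y => (x != y)%:R); split.
- split.
  + by move=> x y; exact: ler0n.
  + move=> x y; split=> [/eqP|->]; last by rewrite eqxx.
    by rewrite pnatr_eq0 eqb0 negbK => /eqP.
  + by move=> x y; rewrite eq_sym.
  + by move=> [] [] [] /=; rewrite ?addr0 ?add0r ?lexx ?ler01 ?addr_ge0 ?ler01.
- move=> U; split=> [_ x Ux|_]; last exact: all_open_bool.
  exists 1 => // y /=; case: eqVneq => [<-//|_]; by rewrite ltxx.
- move=> u /(_ 1 ltr01)[N uN]; exists (u N) => e e0; exists N => n Nn.
  have := uN _ _ Nn (leqnn N); case: eqVneq => //= _.
  by rewrite ltxx.
Qed.

(* Under the uniform law either alternative yields the local Markov condition at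
   k: in the second one, the translation by t exchanges [b k] and its negation,
   so that k carries a fair coin independent of its non-descendants. *)
Definition markov_bits (K : finType) (F : rel K) (b : bits -> K -> bool) : Prop :=
  forall k,
  (forall w w', (forall l, F l k -> b w l = b w' l) -> b w k = b w' k) \/
  (exists t, forall w, b (flip_bits t w) k = ~~ b w k /\
    forall l, l != k -> l \notin descendants F k -> b (flip_bits t w) l = b w l).

Lemma parents_nondescendants (K : finType) (F : rel K) l k : acyclic F ->
  F l k -> l != k /\ l \notin descendants F k.
Proof.
move=> acF lk; split.
  apply: contraTneq lk => ->; apply/negP => kk; have /negP := acF k; apply.
  by rewrite inE; apply/existsP; exists k; rewrite kk connect0.
rewrite !inE; apply/negP => /existsP[m /andP[km ml]].
have /negP := acF k; apply; rewrite inE; apply/existsP.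
by exists m; rewrite km (connect_trans ml)// connect1.
Qed.

Section bit_models.
Variables (R : realType) (K : finType) (F : rel K) (S : K -> ptopologicalType).
Variable W : bits -> borel (prod_topology S).
Hypothesis oS : forall k, all_open (S k).
(** The intended [S] is [sum_spaces], which reduces to [bool] only once the vertex is known to be an
    [inl] or an [inr]; [code] reads off the bit at a variable vertex. *)
Variable code : forall k, S k -> bool.
Arguments code : clear implicits.
Hypothesis code_inj : forall k, injective (code k).
Let b w k := code k (W w k).
Let P : probability bits R := fair_bits R.

Let oprod (A : {set K}) :
  all_open (prod_topology (fun v : {v : K | v \in A} => S (val v))).
Proof. by apply: all_open_prod => v; exact: oS. Qed.

Let eqW w w' k : b w k = b w' k -> W w k = W w' k.
Proof. by move=> /code_inj. Qed.

Let eq_subproj w w' (A : {set K}) :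
  (forall k, k \in A -> b w k = b w' k) -> subproj A (W w) = subproj A (W w').
Proof.
move=> ww'; apply: functional_extensionality_dep => v; apply: eqW.
exact: ww' (valP v).
Qed.

Let subproj_eq w w' (A : {set K}) : subproj A (W w) = subproj A (W w') ->
  forall k, k \in A -> b w k = b w' k.
Proof.
move=> e k kA; rewrite /b; congr (code k).
exact: (congr1 (fun f : prod_topology (fun v : {v : K | v \in A} => S (val v)) =>
  f (exist _ k kA)) e).
Qed.

Let sigma_of_subproj (A : {set K}) (D : set bits) :
  (forall w w', (forall k, k \in A -> b w k = b w' k) -> D w -> D w') ->
  sigma_of ((fun w => subproj A (W w)) : bits -> borel _) D.
Proof.
move=> DA; exists ((fun w => subproj A (W w)) @` D).
  exact: (all_open_measurable _ (@oprod A)).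
rewrite setTI; apply/seteqP; split=> [w [w' Dw' /subproj_eq e]|w Dw]; last by exists w.
exact: DA e Dw'.
Qed.

Lemma markov_bits_compatible : acyclic F -> markov_bits F b -> compatible P F W.
Proof.
move=> acF mb k; have [kdet|[t tk]] := mb k.
  apply: cond_indep_function; try exact: measurable_fun_bits.
  move=> _ [D mD <-]; rewrite setTI; apply: sigma_of_subproj => w w' ww' /=.
  rewrite (@eqW w w')//; apply: kdet => l lk; apply: ww'.
  by rewrite inE.
pose B : set bits := [set w | b w k].
have flipB : flip_bits t @^-1` B = ~` B.
  by apply/seteqP; split=> w /=; rewrite /B /= (tk w).1 => /negP.
have flipCB : flip_bits t @^-1` (~` B) = ~` ~` B.
  exact: (congr1 setC flipB).
have PB M : flip_bits t @^-1` M = M -> P (B `&` M) = ((2^-1)%:E * P M)%E.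
  exact: fair_bits_half.
have PCB M : flip_bits t @^-1` M = M -> P (~` B `&` M) = ((2^-1)%:E * P M)%E.
  exact: fair_bits_half.
have PBT : P B = (2^-1)%:E.
  by rewrite -[X in P X]setIT PB// probability_setT mule1.
have PCBT : P (~` B) = (2^-1)%:E.
  by rewrite -[X in P X]setIT PCB// probability_setT mule1.
apply: (@cond_indep_product _ _ _ _ _ _ _ _ _ _ _ _ _ _ _ _ (fun A => fine (P A)));
  try exact: measurable_fun_bits.
move=> _ _ _ [A _ <-] [A' _ <-] [A'' _ <-]; rewrite !setTI.
set M := _ @^-1` A' `&` _.
have flipM : flip_bits t @^-1` M = M.
  rewrite /M preimage_setI; congr (_ `&` _); apply/seteqP.
    split=> w /=; rewrite (@eq_subproj _ w)// => l;
    by rewrite finset.in_setC in_setU1 negb_or => /andP[lk ld]; exact: (tk w).2.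
  split=> w /=; rewrite (@eq_subproj _ w)// => l; rewrite inE => lk;
    have [lk' ld] := parents_nondescendants acF lk; exact: (tk w).2.
set D := _ @^-1` A.
(* [D] depends on the single bit at [k], so it is [B], its complement, the whole space or empty;
   these are the four cases below. *)
have Db w w' : b w k = b w' k -> D w -> D w'.
  by move=> /eqW; rewrite /D /= => ->.
have [[w0 [w0B w0D]]|noB] := pselect (exists w, b w k /\ D w).
  have BD : B `<=` D by move=> w wB; apply: Db w0D; rewrite w0B; exact/esym.
  have [[w1 [w1B w1D]]|noCB] := pselect (exists w, ~ b w k /\ D w).
    have -> : D = setT.
      apply/seteqP; split=> // w _; have [wB|wB] := boolP (b w k); first exact: BD.
      by apply: Db w1D; rewrite (negbTE wB); exact/negbTE/negP.
    by rewrite setTI probability_setT/= mul1e.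
  have -> : D = B.
    apply/seteqP; split=> // w Dw; apply: contrapT => wB; apply: noCB.
    by exists w.
  by rewrite PB// PBT.
have [[w1 [w1B w1D]]|noCB] := pselect (exists w, ~ b w k /\ D w).
  have -> : D = ~` B.
    apply/seteqP; split=> w; first by move=> Dw wB; apply: noB; exists w.
    move=> /negP wB; apply: Db w1D; rewrite (negbTE wB).
    exact/negbTE/negP.
  by rewrite PCB// PCBT.
have -> : D = set0.
  apply/seteqP; split=> // w Dw; have [wB|/negP wB] := boolP (b w k).
    by apply: noB; exists w.
  by apply: noCB; exists w.
by rewrite set0I measure0/= mul0e.
Qed.

(** The bit at [k] is a function of the non-descendants, while the translation by [t] makes it a
    fair coin given the parents. *)
Lemma not_markov_bits_compatible k t :
  (forall w w', (forall l, l != k -> l \notin descendants F k -> b w l = b w' l) ->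
    b w k = b w' k) ->
  (forall w, b (flip_bits t w) k = ~~ b w k /\
    forall l, F l k -> b (flip_bits t w) l = b w l) ->
  ~ compatible P F W.
Proof.
move=> kdet tk /(_ k); pose B : set bits := [set w | b w k].
have flipB : flip_bits t @^-1` B = ~` B.
  by apply/seteqP; split=> w /=; rewrite /B /= (tk w).1 => /negP.
apply: (@not_cond_indep _ _ _ _ _ _ _ _ _ _ _ _ _ _ _ _ B);
  try exact: measurable_fun_bits.
- exists [set x : S k | code k x]; last by rewrite setTI.
  exact: all_open_measurable.
- apply: sigma_of_subproj => w w' ww'; rewrite /B /= => wB.
  rewrite -(kdet w w')// => l lk ld; apply: ww'.
  by rewrite finset.in_setC in_setU1 negb_or lk.
- move=> _ [A _ <-]; rewrite setTI; apply: (fair_bits_half R flipB).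
  apply/seteqP; split=> w /=; rewrite (@eq_subproj _ w)// => l; rewrite inE => lk;
  exact: (tk w).2.
Qed.

End bit_models.

Lemma causal_graph_connect_inl (V : finType) (E : rel V) i j :
  connect (causal_graph E) (inl i) (inl j) -> connect E i j.
Proof.
case/connectP => p; elim: p i => [|[l|l] p IH] i /=; first by move=> _ [->].
  by move=> /andP[il pp] e; apply: connect_trans (connect1 il) (IH _ pp e).
move=> /andP[_ pp] e; exfalso; elim: p l pp e {IH} => [|[m|m] p IH] l //=.
by move=> /andP[_ pp] e; exact: IH pp e.
Qed.

Lemma causal_graph_connect_inr (V : finType) (E : rel V) i u :
  connect (causal_graph E) (inr i) u -> exists2 j, u = inr j & connect E i j.
Proof.
case/connectP => p; elim: p i => [|[l|l] p IH] i //=.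
  by move=> _ ->; exists i.
move=> /andP[il pp] e; have [j -> lj] := IH _ pp e.
by exists j => //; exact: connect_trans (connect1 il) lj.
Qed.

Lemma causal_graph_descendants_inl (V : finType) (E : rel V) i j :
  (inl j \in descendants (causal_graph E) (inl i)) -> j \in descendants E i.
Proof.
rewrite !inE => /existsP[[l|l] /andP[/= il lj]]; last first.
  by have [] := causal_graph_connect_inr lj.
by apply/existsP; exists l; rewrite il causal_graph_connect_inl.
Qed.

Lemma causal_graph_acyclic (V : finType) (E : rel V) :
  acyclic E -> acyclic (causal_graph E).
Proof.
move=> acE [i|i]; apply/negP.
  move=> ii; have /negP := acE i; apply.
  have : inl i \in descendants (causal_graph E) (inl i) by rewrite inE.
  by move=> /causal_graph_descendants_inl; rewrite inE.
rewrite inE => /existsP[[l|l] /andP[//= il li]].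
have [j [<-] lj] := causal_graph_connect_inr li.
have /negP := acE i; apply; rewrite inE; apply/existsP.
by exists l; rewrite il.
Qed.

(** Edges of G^c never return from copies to originals. Thanks to this, a check on a pair of
    processes also yields G-compatibility of the first one. *)
Lemma markov_bits_inl (V : finType) (E : rel V) (b : bits -> V + V -> bool) :
  markov_bits (causal_graph E) b -> markov_bits E (fun w v => b w (inl v)).
Proof.
move=> mb k; have [kdet|[t tk]] := mb (inl k).
  by left=> w w' ww'; apply: kdet => -[l|l] //=; exact: ww'.
right; exists t => w; split=> [|l lk ld]; first exact: (tk w).1.
apply: (tk w).2 => //; apply: contraNN ld; exact: causal_graph_descendants_inl.
Qed.

(** * Decision procedure for models with six active vertices *)

Local Notation triple := (bool * bool * bool)%type.

Definition triple_seq (x : triple) : seq bool := [:: x.1.1; x.1.2; x.2].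

(* Six-vertex models: positions 0, 1, 2 stand for the vertices i, j, k of the
   first process, and 3, 4, 5 for those of the second. *)
Definition entry (x y : bits -> triple) (w : triple) (n : nat) : bool :=
  nth false (triple_seq (x w) ++ triple_seq (y w)) n.

Definition determined (val : triple -> nat -> bool) (s : seq nat) (n : nat) : bool :=
  all (fun w => all (fun w' =>
    all (fun l => val w l == val w' l) s ==> (val w n == val w' n)) all_bits) all_bits.

Definition negated (val : triple -> nat -> bool) (s : seq nat) (n : nat)
    (t : triple) : bool :=
  all (fun w => (val (flip_bits t w) n == ~~ val w n) &&
    all (fun l => val (flip_bits t w) l == val w l) s) all_bits.

Definition markov_entries (val : triple -> nat -> bool) (pa nd : seq (seq nat)) : bool :=
  all (fun n => determined val (nth [::] pa n) n ||
    has (negated val (nth [::] nd n) n) all_bits) (iota 0 6).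

Section processes.
Variables (V : finType) (E : rel V) (i j k : V).
Hypotheses (ij : i != j) (ik : i != k) (jk : j != k).

(** At any vertex other than the three [index] is 3, so [nth] returns its default: those vertices
    carry a constant, which satisfies every Markov condition. *)
Definition process (x : triple) (v : V) : bool :=
  nth false (triple_seq x) (index v [:: i; j; k]).

Definition process_pair (x y : bits -> triple) (w : bits) (u : V + V) : bool :=
  match u with inl v => process (x w) v | inr v => process (y w) v end.

Definition node (n : nat) : V + V :=
  nth (inl i) [:: inl i; inl j; inl k; inr i; inr j; inr k] n.

Let process3 x : [/\ process x i = x.1.1, process x j = x.1.2 & process x k = x.2].
Proof.
by rewrite /process /= !eqxx (negbTE ij) (negbTE ik) (negbTE jk).
Qed.

Lemma process_pair_node x y w n : (n < 6)%N ->
  process_pair x y w (node n) = entry x y w n.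
Proof.
have [x1 x2 x3] := process3 (x w); have [y1 y2 y3] := process3 (y w).
by case: n => [|[|[|[|[|[|//]]]]]] _ /=.
Qed.

Lemma process_out x v : v \notin [:: i; j; k] -> process x v = false.
Proof. by move=> vN; rewrite /process memNindex//; exact: nth_default. Qed.

Lemma nodeP u : (exists2 n, (n < 6)%N & u = node n) \/
  (forall x y w, process_pair x y w u = false).
Proof.
case: u => v; have [vs|vs] := boolP (v \in [:: i; j; k]);
  try by right=> x y w; exact: process_out.
  by left; move: vs; rewrite !inE => /or3P[]/eqP->; [exists 0%N|exists 1%N|exists 2%N].
by left; move: vs; rewrite !inE => /or3P[]/eqP->; [exists 3%N|exists 4%N|exists 5%N].
Qed.

Lemma determinedP x y s n : determined (entry x y) s n -> (n < 6)%N ->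
  all (fun l => l < 6)%N s -> forall w w',
  (forall l, l \in s -> process_pair x y w (node l) = process_pair x y w' (node l)) ->
  process_pair x y w (node n) = process_pair x y w' (node n).
Proof.
move=> /allP dn n6 /allP s6 w w' ww'.
have /allP/(_ w' (mem_all_bits _))/implyP := dn w (mem_all_bits _).
rewrite !process_pair_node// => h; apply/eqP/h/allP => l ls.
by rewrite -!process_pair_node ?s6// ww'.
Qed.

Lemma negatedP x y s n t : negated (entry x y) s n t -> (n < 6)%N ->
  all (fun l => l < 6)%N s -> forall w,
  process_pair x y (flip_bits t w) (node n) = ~~ process_pair x y w (node n) /\
  forall l, l \in s ->
    process_pair x y (flip_bits t w) (node l) = process_pair x y w (node l).
Proof.
move=> /allP tn n6 /allP s6 w; have /andP[/eqP wn /allP ws] := tn w (mem_all_bits _).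
rewrite !process_pair_node//; split=> // l ls.
by rewrite !process_pair_node ?s6//; exact/eqP/ws.
Qed.

(** One inclusion suffices for each table: [pa] may omit parents and [nd] may list too many
    vertices, since either error only strengthens the check. *)
Lemma markov_entriesP pa nd x y :
  all (all (fun l => l < 6)%N) pa -> all (all (fun l => l < 6)%N) nd ->
  (forall n l, (n < 6)%N -> l \in nth [::] pa n -> causal_graph E (node l) (node n)) ->
  (forall n l, (n < 6)%N -> (l < 6)%N -> l != n -> l \notin nth [::] nd n ->
    node l \in descendants (causal_graph E) (node n)) ->
  markov_entries (entry x y) pa nd ->
  markov_bits (causal_graph E) (process_pair x y).
Proof.
move=> pa6 nd6 paE ndE /allP me u.
have in6 (s : seq (seq nat)) n : all (all (fun l => l < 6)%N) s ->
    all (fun l => l < 6)%N (nth [::] s n).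
  move=> /allP s6; have [ns|ns] := ltnP n (size s); first exact: s6 (mem_nth _ ns).
  by rewrite nth_default.
have [[n n6 ->]|u0] := nodeP u; last by left=> w w' _; rewrite !u0.
have /orP[dn|/hasP[t _ tn]] := me n (ltac:(by rewrite mem_iota)).
  left=> w w' ww'; apply: (determinedP dn n6 (in6 _ _ pa6)) => l ln.
  by apply: ww'; exact: paE.
right; exists t => w; have [-> tl] := negatedP tn n6 (in6 _ _ nd6) w.
split=> // v; have [[l l6 ->]|v0 _ _] := nodeP v; last by rewrite !v0.
move=> ln ld; apply: tl; apply: contraNT ld; apply: ndE => //.
by apply: contraNneq ln => ->.
Qed.

End processes.

(** * From bit models to couplings without the gluing properties *)

Section counterexample.
Variables (R : realType) (V : finType) (E : rel V).
Hypothesis acE : acyclic E.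
Variables i j k : V.
Hypotheses (ij : i != j) (ik : i != k) (jk : j != k).
Let P : probability bits R := fair_bits R.
Let Bv : V -> ptopologicalType := fun _ => bool.
Let T : ptopologicalType := prod_topology Bv.

Let oT : all_open T.
Proof. by apply: all_open_prod => v; exact: all_open_bool. Qed.

Let process_bits (x : bits -> triple) (w : bits) : borel T := process i j k (x w).

Definition pair_process (x y : bits -> triple) (w : bits) :
    borel (prod_topology (sum_spaces Bv Bv)) :=
  join (process_bits x w, process_bits y w).

Definition bool_code (u : V + V) : sum_spaces Bv Bv u -> bool :=
  match u with inl _ => id | inr _ => id end.

Let bool_codeE x y :
  (fun w u => bool_code (pair_process x y w u)) = process_pair i j k x y.
Proof. by apply/funext => w; apply/funext => -[u|u]. Qed.

Let bool_code_inj u : injective (@bool_code u).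
Proof. by case: u => u a b. Qed.

Let all_open_sum u : all_open (sum_spaces Bv Bv u).
Proof. by case: u => u; exact: all_open_bool. Qed.

Let markov_compatible_pair x y :
  markov_bits (causal_graph E) (process_pair i j k x y) ->
  compatible P (causal_graph E) (pair_process x y).
Proof.
move=> m; apply: (markov_bits_compatible R all_open_sum bool_code_inj).
  exact: causal_graph_acyclic.
by rewrite bool_codeE.
Qed.

Let markov_compatible x y :
  markov_bits (causal_graph E) (process_pair i j k x y) ->
  compatible P E (process_bits x).
Proof.
move=> /markov_bits_inl m.
exact: (@markov_bits_compatible R V E Bv (process_bits x) (fun _ => all_open_bool)
  (fun _ => id) (fun _ => @inj_id bool) acE m).
Qed.

HB.instance Definition _ (x : bits -> triple) :=
  @isMeasurableFun.Build _ _ _ _ (process_bits x) (measurable_fun_bits _).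

Let law x : probability (borel T) R := distribution P (process_bits x).

Let pair_bits (x y : bits -> triple) (w : bits) : borel (T * T) :=
  (process_bits x w, process_bits y w).

HB.instance Definition _ (x y : bits -> triple) :=
  @isMeasurableFun.Build _ _ _ _ (pair_bits x y) (measurable_fun_bits _).

Let law2 x y : probability (borel (T * T)) R := distribution P (pair_bits x y).

Let law_compatible x y :
  markov_bits (causal_graph E) (process_pair i j k x y) ->
  compatible_measure E (law x).
Proof.
move=> m; apply/(compatible_law E (measurable_fun_bits (process_bits x))).
- by [].
- exact: measurable_id.
- exact: markov_compatible m.
Qed.

Let law2_compatible x y :
  compatible (law2 x y) (causal_graph E) (@join V Bv Bv) <->
  compatible P (causal_graph E) (pair_process x y).
Proof.
apply: (compatible_law (causal_graph E) (measurable_fun_bits (pair_bits x y))) => //.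
exact: joint_measurable.
Qed.

Let law2_causal x y :
  markov_bits (causal_graph E) (process_pair i j k x y) ->
  causal_coupling E (law x) (law y) (law2 x y).
Proof. by move=> m; split=> //; apply/law2_compatible; exact: markov_compatible_pair. Qed.

Let law2_bicausal x y :
  markov_bits (causal_graph E) (process_pair i j k x y) ->
  markov_bits (causal_graph E) (process_pair i j k y x) ->
  bicausal_coupling E (law x) (law y) (law2 x y).
Proof.
move=> mxy myx; split; first exact: law2_causal.
split=> //; split=> //; have [_] := law2_causal myx.
move/law2_compatible => c.
apply/(compatible_law (causal_graph E) (measurable_fun_bits (pair_bits y x))
  (P := P)) => //.
exact: joint_measurable.
Qed.

Variables (x y : bits -> triple) (f : triple -> triple).

Let z w := f (y w).

Let F (u : borel T) : borel T := process i j k (f (u i, u j, u k)).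

Let measurable_all d (U : measurableType d) (S : ptopologicalType) (g : borel S -> U) :
  all_open S -> measurable_fun setT g.
Proof. by move=> oS _ D _; exact: all_open_measurable. Qed.

Let Fy w : F (process_bits y w) = process_bits z w.
Proof.
rewrite /F /process_bits /z; congr (process _ _ _ (f _)).
rewrite /process /= !eqxx (negbTE ij) (negbTE ik) (negbTE jk) /=.
by case: (y w) => [[]].
Qed.

Let triple_bits w : borel (T * T * T) :=
  (process_bits x w, process_bits y w, process_bits z w).

HB.instance Definition _ :=
  @isMeasurableFun.Build _ _ _ _ triple_bits (measurable_fun_bits _).

Let law3 : probability (borel (T * T * T)) R := distribution P triple_bits.

Let kdirac_disintegrates (S : ptopologicalType) (m : probability (borel S) R)
    (p : probability (borel (S * T)) R) (g : borel S -> borel T) : all_open S ->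
  (forall D, measurable D -> p D = m ((fun a => (a, g a)) @^-1` D)) ->
  disintegrates p m (fun a => \d_(g a)).
Proof.
move=> oS pE D mD; rewrite pE//.
transitivity (\int[m]_a (\1_((fun a : borel S => (a, g a)) @^-1` D) a)%:E)%E.
  by rewrite integral_indic ?setIT//; exact: all_open_measurable.
apply: eq_integral => a _; rewrite /= /dirac !indicE; congr ((_ : bool)%:R%:E).
by apply/idP/idP; rewrite !inE => /xsectionP.
Qed.

(** As Z is the function [F] of Y, the Dirac kernel at [F] disintegrates the law of (Y, Z), and
    attached to the law of (X, Y) it gives the law of (X, Y, Z). *)
Lemma laws_gluing : is_gluing (law y) (law2 x y) (law2 y z) (law2 x z).
Proof.
have mF : measurable_fun setT F by exact: measurable_all.
exists law3 => //; exists (kdirac mF); split.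
  apply: kdirac_disintegrates => // D mD.
  by rewrite /law2 /law /distribution /pushforward /=; congr (fair_bits R _);
    apply/seteqP; split=> w /=; rewrite /pair_bits Fy.
apply: (kdirac_disintegrates (g := fun ab => F ab.2)); first exact: all_open_pair.
move=> D mD; rewrite /law3 /law2 /distribution /pushforward /=.
by congr (fair_bits R _); apply/seteqP; split=> w /=; rewrite /triple_bits /pair_bits Fy.
Qed.

Lemma no_gluing_property :
  markov_bits (causal_graph E) (process_pair i j k x y) ->
  markov_bits (causal_graph E) (process_pair i j k y x) ->
  markov_bits (causal_graph E) (process_pair i j k y z) ->
  markov_bits (causal_graph E) (process_pair i j k z y) ->
  ~ compatible P (causal_graph E) (pair_process x z) ->
  ~ causal_gluing_property R E /\ ~ bicausal_gluing_property R E.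
Proof.
move=> mxy myx myz mzy nxz.
have pB v : polish R (Bv v) by exact: polish_bool.
have cx := law_compatible mxy; have cy := law_compatible myx.
have cz := law_compatible mzy.
split=> glue.
  have [_ /law2_compatible//] := glue _ _ _ pB pB pB _ _ _ cx cy cz _ _ _
    (law2_causal mxy) (law2_causal myz) laws_gluing.
have [[_ /law2_compatible//]] := glue _ _ _ pB pB pB _ _ _ cx cy cz _ _ _
  (law2_bicausal mxy myx) (law2_bicausal myz mzy) laws_gluing.
Qed.

(** Here the tables err on the opposite sides: [s] needs only enough non-descendants to determine
    entry [n], while [s'] must cover all parents among the six positions. *)
Lemma pair_process_not_compatible n s s' t : (n < 6)%N ->
  all (fun l => l < 6)%N s -> all (fun l => l < 6)%N s' ->
  (forall l, l \in s -> node i j k l != node i j k n /\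
    node i j k l \notin descendants (causal_graph E) (node i j k n)) ->
  (forall l, (l < 6)%N -> causal_graph E (node i j k l) (node i j k n) -> l \in s') ->
  determined (entry x z) s n -> negated (entry x z) s' n t ->
  ~ compatible P (causal_graph E) (pair_process x z).
Proof.
move=> n6 s6 s'6 sN s'P dn tn.
have bE w u : bool_code (pair_process x z w u) = process_pair i j k x z w u.
  by rewrite -bool_codeE.
apply: (@not_markov_bits_compatible R _ (causal_graph E) _ (pair_process x z)
  all_open_sum _ bool_code_inj (node i j k n) t).
  move=> w w' ww'; rewrite !bE; apply: (determinedP ij ik jk dn) => // l ls.
  by rewrite -!bE; apply: ww'; [exact: (sN l ls).1|exact: (sN l ls).2].
move=> w; rewrite !bE; have [-> tl] := negatedP ij ik jk tn n6 s'6 w.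
split=> // l ln; rewrite !bE.
have [[m m6 lE]|l0] := nodeP i j k l; last by rewrite !l0.
by rewrite lE; apply: tl; apply: s'P => //; rewrite -lE.
Qed.

End counterexample.

(** * Chains and splits *)

Lemma descendants1 (K : finType) (F : rel K) u v : F u v -> v \in descendants F u.
Proof. by move=> uv; rewrite !inE; apply/existsP; exists v; rewrite uv connect0. Qed.

Lemma descendants2 (K : finType) (F : rel K) v u w :
  F u v -> F v w -> w \in descendants F u.
Proof.
by move=> uv vw; rewrite !inE; apply/existsP; exists v; rewrite uv connect1.
Qed.

Lemma causal_graph_inl_notin_descendants (V : finType) (E : rel V) i j :
  inl i \notin descendants (causal_graph E) (inr j).
Proof.
rewrite !inE; apply/negP => /existsP[[l|l] /andP[//= _ li]].
by have [] := causal_graph_connect_inr li.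
Qed.

Section necessity.
Variables (R : realType) (V : finType) (E : rel V).
Hypotheses (irrE : irreflexive E) (acE : acyclic E).

(* For w = (a, b, c), the triples below are the values at (i, j, k) of
   X = (a, b, c), Y = (0, a + b, c) and Z = (0, 0, a + b + c): given the parents
   of k' in G^c, the variable Z_k is a fair coin, yet it is a function of X. *)
Lemma no_gluing_chain i j k : E i j -> E j k -> ~~ E i k ->
  ~ causal_gluing_property R E /\ ~ bicausal_gluing_property R E.
Proof.
move=> Eij Ejk Eik.
have ij : i != j by apply: contraTneq Eij => ->; rewrite irrE.
have jk : j != k by apply: contraTneq Ejk => ->; rewrite irrE.
have ik : i != k.
  apply: contraTneq Ejk => <-; apply/negP => Eji; have /negP := acE i; apply.
  by have := descendants2 Eij Eji; rewrite inE.
pose x : bits -> triple := id.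
pose y : bits -> triple := fun w => (false, w.1.1 (+) w.1.2, w.2).
pose f : triple -> triple := fun u => (false, false, u.1.2 (+) u.2).
(* Rows follow the order i, j, k, i', j', k'; for instance the last one gives j, k and j' as parents
   of k'. *)
pose pa := [:: [::]; [:: 0]; [:: 1]; [:: 0]; [:: 0; 1; 3]; [:: 1; 2; 4]]%N.
pose nd := [:: [::]; [:: 0; 3]; [:: 0; 1; 3; 4]; [:: 0; 1; 2]; [:: 0; 1; 2; 3];
  [:: 0; 1; 2; 3; 4]]%N.
have paE n l : (n < 6)%N -> l \in nth [::] pa n ->
    causal_graph E (node i j k l) (node i j k n).
  by case: n => [|[|[|[|[|[|//]]]]]] _; rewrite !inE //=;
    repeat case/orP; move=> /eqP -> /=; rewrite ?Eij ?Ejk ?eqxx ?orbT.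
have ndE n l : (n < 6)%N -> (l < 6)%N -> l != n -> l \notin nth [::] nd n ->
    node i j k l \in descendants (causal_graph E) (node i j k n).
  case: n => [|[|[|[|[|[|//]]]]]] _; case: l => [|[|[|[|[|[|//]]]]]] //= _ _ _;
  first [by apply: descendants1; rewrite /= ?Eij ?Ejk ?eqxx ?orbT
    | by apply: (descendants2 (v := inl j)); rewrite /= ?Eij ?Ejk
    | by apply: (descendants2 (v := inr j)); rewrite /= ?Eij ?Ejk].
have pair_markov := markov_entriesP ij ik jk _ _ paE ndE.
apply: (no_gluing_property acE ij ik jk (x := x) (y := y) (f := f)).
- by apply: pair_markov; vm_compute.
- by apply: pair_markov; vm_compute.
- by apply: pair_markov; vm_compute.
- by apply: pair_markov; vm_compute.
(* Position 5 is k', where Z_k = a + b + c is determined by X. Flipping the bit a negates it and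
   fixes X_j = b, X_k = c and Z_j = 0, the values at the parents of k'; X_i = a is not among them,
   for lack of the edge from i to k. *)
apply: (pair_process_not_compatible ij ik jk (n := 5) (s := [:: 0; 1; 2]%N)
  (s' := [:: 1; 2; 4]%N) (t := (true, false, false))) => //.
- move=> l; rewrite 2!in_cons mem_seq1 => /or3P[] /eqP -> /=; split => //;
  exact: causal_graph_inl_notin_descendants.
- case=> [|[|[|[|[|[|//]]]]]] //= _; rewrite ?(negbTE Eik) ?(negbTE ik) ?irrE//.
Qed.

(* Here X = (0, b, c), Y = (a, b, c) and Z = (0, a + b, a + c): given the parents
   of j' in G^c, the variable Z_j is a fair coin, yet it is a function of X_j,
   X_k and Z_k. *)
Lemma no_gluing_split i j k : transitive E -> is_split E i j k ->
  ~ causal_gluing_property R E /\ ~ bicausal_gluing_property R E.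
Proof.
move=> trE [jk]; rewrite !inE => /andP[Eij Eik] Ejk Ekj.
have ij : i != j by apply: contraTneq Eij => ->; rewrite irrE.
have ik : i != k by apply: contraTneq Eik => ->; rewrite irrE.
pose x : bits -> triple := fun w => (false, w.1.2, w.2).
pose y : bits -> triple := id.
pose f : triple -> triple := fun u => (false, u.1.1 (+) u.1.2, u.1.1 (+) u.2).
pose pa := [:: [::]; [:: 0]; [:: 0]; [:: 0]; [:: 0; 1; 3]; [:: 0; 2; 3]]%N.
pose nd := [:: [::]; [:: 0; 2; 3; 5]; [:: 0; 1; 3; 4]; [:: 0; 1; 2];
  [:: 0; 1; 2; 3; 5]; [:: 0; 1; 2; 3; 4]]%N.
have paE n l : (n < 6)%N -> l \in nth [::] pa n ->
    causal_graph E (node i j k l) (node i j k n).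
  by case: n => [|[|[|[|[|[|//]]]]]] _; rewrite !inE //=;
    repeat case/orP; move=> /eqP -> /=; rewrite ?Eij ?Eik ?eqxx ?orbT.
have ndE n l : (n < 6)%N -> (l < 6)%N -> l != n -> l \notin nth [::] nd n ->
    node i j k l \in descendants (causal_graph E) (node i j k n).
  by case: n => [|[|[|[|[|[|//]]]]]] _; case: l => [|[|[|[|[|[|//]]]]]] //= _ _ _;
  apply: descendants1; rewrite /= ?Eij ?Eik ?eqxx ?orbT.
have pair_markov := markov_entriesP ij ik jk _ _ paE ndE.
apply: (no_gluing_property acE ij ik jk (x := x) (y := y) (f := f)).
- by apply: pair_markov; vm_compute.
- by apply: pair_markov; vm_compute.
- by apply: pair_markov; vm_compute.
- by apply: pair_markov; vm_compute.
(* Position 4 is j', where Z_j = a + b is the sum of X_j, X_k and Z_k. Flipping a negates it and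
   fixes X_i, X_j and Z_i, the values at the parents of j'. *)
apply: (pair_process_not_compatible ij ik jk (n := 4) (s := [:: 0; 1; 2; 5]%N)
  (s' := [:: 0; 1; 3]%N) (t := (true, false, false))) => //.
- move=> l; rewrite 3!in_cons mem_seq1 => /or4P[] /eqP -> /=; split => //;
  try exact: causal_graph_inl_notin_descendants.
    by apply: contra_neq jk => -[].
  (* A split only excludes the edge from j to k; transitivity, which the chain example provides,
     excludes longer paths as well. *)
  by rewrite (descendants_trans _ (causal_graph_trans trE)) inE.
- by case=> [|[|[|[|[|[|//]]]]]] //= _;
  rewrite ?(negbTE Ekj) ?(negbTE jk) 1?eq_sym ?(negbTE jk) ?irrE.
Qed.

Lemma gluing_transitive_no_splits :
  causal_gluing_property R E \/ bicausal_gluing_property R E ->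
  transitive E /\ has_no_splits E.
Proof.
move=> glue; have trE : transitive E.
  move=> j i k Eij Ejk; apply: contrapT => /negP Eik.
  by have [nc nb] := no_gluing_chain Eij Ejk Eik; case: glue.
split=> // i j k ijk; have [nc nb] := no_gluing_split trE ijk.
by case: glue.
Qed.

End necessity.

Unset Implicit Arguments.

Theorem theorem4p11 (R : realType) (V : finType) (E : rel V)
    (irrE : irreflexive E) (acycE : acyclic E) :
  [<-> causal_gluing_property R E;
       bicausal_gluing_property R E;
       transitive E /\ has_no_splits E].
Proof.
tfae.
(* The detour through the graph condition handles anticausality: applying causal gluing to the
   swapped couplings would require a kernel from Y to X, whereas [is_gluing] provides one from Y to
   Z. *)
- move=> cE; have [trE nsE] := gluing_transitive_no_splits irrE acycE (or_introl cE).
  move=> X Y Z pX pY pZ mu nu eta _ _ _ pi pi' gamma [c1 a1] [c2 a2] glue.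
  split; first exact: (causal_glue irrE trE nsE pX pY pZ c1.1 c2.1 glue).
  exact: (anticausal_glue irrE trE nsE pX pY pZ c1.1 c2.1 glue).
- by move=> bE; exact: (gluing_transitive_no_splits irrE acycE (or_intror bE)).
- move=> [trE nsE] X Y Z pX pY pZ mu nu eta _ _ _ pi pi' gamma c1 c2 glue.
  exact: (causal_glue irrE trE nsE pX pY pZ c1.1 c2.1 glue).
Qed.
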